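(* Let $a,b$ be positive integers, let $\phi=\frac{1+\sqrt5}{2}$, and let $(U_k)_{k\ge 0}$ be the unique sequence of positive integers such that (1) $U_0\ge U_1$; (2) $U_{k+2}=U_{k+1}+U_k$ for all $k\ge 0$; (3) for some $q\ge 0$, $U_q=\min\{a,b\}$ and $U_{q+1}=\max\{a,b\}$. For a positive integer $n$ let $G=(n;a,b)$ be the single-heap Robin Hood position. If $n\ge a+b$, then $G$ is a hot game. Moreover, for all sufficiently large $n$ (depending on $a,b$), the temperature $t(G)$ of $G$ is $$t(G)=\begin{cases} b-U_0 & \text{if } \frac ab<\phi^{-1},\\ n-a+\frac{U_0-b}{2} & \text{if } \phi^{-1}<\frac ab<1,\\ n-a & \text{if } \frac ab=1,\\ n-b+\frac{U_0-a}{2} & \text{if } 1<\frac ab<\phi,\\ a-U_0 & \text{if } \phi<\frac ab,\end{cases}$$ and the mean value $m(G)$ of $G$ is $$m(G)=\begin{cases} -\left(n-(a+b)+U_0\right) & \text{if } \frac ab<\phi^{-1},\\ \frac{U_0-b}{2} & \text{if } \phi^{-1}<\frac ab<1,\\ 0 & \text{if } \frac ab=1,\\ \frac{a-U_0}{2} & \text{if } 1<\frac ab<\phi,\\ n-(a+b)+U_0 & \text{if } \phi<\frac ab.\end{cases}$$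
   Context: Games are short partizan combinatorial games (players Left and Right) under normal play (a player who cannot move loses); equality, order, sums and canonical forms of games are the usual ones. Robin Hood: for non-negative integers $n,a,b$ (heap size, Left's wealth, Right's wealth), the position $(n;a,b)$ has Left options $(n-i;\,a,\,\max\{b-i,0\})$ for $1\le i\le\min\{n,a\}$ and Right options $(n-j;\,\max\{a-j,0\},\,b)$ for $1\le j\le \min\{n,b\}$. Dyadics: integers and dyadic rationals $k/2^n$ are identified with the usual number games. Stops: if $G$ equals a dyadic $x$, then its Left stop $\mathrm{Ls}(G)$ and Right stop $\mathrm{Rs}(G)$ are both $x$; otherwise $\mathrm{Ls}(G)=\max_{G^L}\mathrm{Rs}(G^L)$ and $\mathrm{Rs}(G)=\min_{G^R}\mathrm{Ls}(G^R)$, over Left options $G^L$ and Right options $G^R$. Penalized position: for $G$ in canonical form and a non-negative dyadic $p$, $G_p$ is defined recursively by $G_p=\{(G^{L})_p-p \mid (G^{R})_p+p\}$ ($G^L$, $G^R$ ranging over all Left and Right options) for $0\le p\le \tau$, where $\tau$ is the minimum $p$ for which the Left and Right stops of $G_p$ are equal to a dyadic, say $x$; and $G_p=x$ for all $p>\tau$. Temperature: if $G$ equals a dyadic $k/2^n$ ($n\ge 0$, with $k$ odd if $n>0$), then $t(G)=-1/2^n$; otherwise $t(G)$ is the smallest non-negative dyadic $p$ with $\mathrm{Ls}(G_p)=\mathrm{Rs}(G_p)$. $G$ is hot if $t(G)>0$. Mean value: $m(G)$ is the number such that for every positive dyadic $\epsilon$ and all sufficiently large integers $N$, $N\cdot(m(G)-\epsilon)\le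 N\cdot G\le N\cdot (m(G)+\epsilon)$, where $N\cdot G$ is the disjunctive sum of $N$ copies of $G$. *)

(* Defs.v *)
From mathcomp Require Import all_boot all_order all_algebra.
From mathcomp Require Import boolp reals.

Set Implicit Arguments.
Unset Strict Implicit.
Unset Printing Implicit Defensive.

Import Order.TTheory GRing.Theory Num.Theory.
Local Open Scope ring_scope.

(* Short games, given by their lists of Left and Right options. *)
Inductive game : Type := Game of seq game & seq game.

Definition left_options (G : game) : seq game := let: Game L _ := G in L.
Definition right_options (G : game) : seq game := let: Game _ R := G in R.

Definition gzero : game := Game [::] [::].

Fixpoint gopp (G : game) : game :=
  let: Game L R := G in Game [seq gopp g | g <- R] [seq gopp g | g <- L].

Fixpoint gadd (G : game) : game -> game :=
  let: Game GL GR := G in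
  fix gaddG (H : game) : game :=
    let: Game HL HR := H in
    Game ([seq gadd g H | g <- GL] ++ [seq gaddG h | h <- HL])
         ([seq gadd g H | g <- GR] ++ [seq gaddG h | h <- HR]).

Definition gmuln (N : nat) (G : game) : game := iter N (gadd G) gzero.

(* [left_wins b G]: under normal play Left wins G, where Left moves first if
   [b] and Right moves first otherwise. *)
Fixpoint left_wins (left_first : bool) (G : game) : bool :=
  let: Game L R := G in
  if left_first then has (left_wins false) L else all (left_wins true) R.

(* G <= H iff Left wins H - G playing second. *)
Definition gle (G H : game) : bool := left_wins false (gadd H (gopp G)).
Definition geqv (G H : game) : bool := gle G H && gle H G.

(* No option is dominated or reversible, hereditarily. Quantifying domination
   over pairs of positions in the lists also excludes repeated options. *)
Fixpoint is_canonical (G : game) : bool :=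
  let: Game L R := G in
  [&& pairwise (fun g h => ~~ gle g h && ~~ gle h g) L,
      pairwise (fun g h => ~~ gle g h && ~~ gle h g) R,
      all (fun g => all (fun gr => ~~ gle gr G) (right_options g)) L,
      all (fun g => all (fun gl => ~~ gle G gl) (left_options g)) R,
      all is_canonical L
    & all is_canonical R].

Definition canonical_form (G C : game) : bool := is_canonical C && geqv C G.

Definition dyadic (x : rat) : Prop :=
  exists (k : int) (n : nat), x = k%:~R / 2 ^+ n.

Definition integer_game (k : int) : game :=
  match k with
  | Posz n => iter n (fun g => Game [:: g] [::]) gzero
  | Negz n => iter n.+1 (fun g => Game [::] [:: g]) gzero
  end.

(* The number game k / 2 ^ n, with k not necessarily odd. For k odd and n > 0
   it is {(k - 1) / 2 ^ n | (k + 1) / 2 ^ n}. *)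
Fixpoint dyadic_game (n : nat) (k : int) : game :=
  if n is n'.+1 then
    if (2 %| k)%Z then dyadic_game n' (k %/ 2)%Z
    else Game [:: dyadic_game n' ((k - 1) %/ 2)%Z]
              [:: dyadic_game n' ((k + 1) %/ 2)%Z]
  else integer_game k.

(* Meaningful only for dyadic x, whose reduced denominator is a power of 2. *)
Definition number_game (x : rat) : game :=
  dyadic_game (logn 2%N `|denq x|%N) (numq x).

Definition equals_dyadic (G : game) (x : rat) : Prop :=
  dyadic x /\ geqv G (number_game x).

Definition number_value (G : game) : option rat :=
  if pselect (exists x, equals_dyadic G x) is left h
  then Some (projT1 (cid h)) else None.

(* The value 0 on the empty list is never used by the stops below: a game
   without Left options, or without Right options, is equal to an integer. *)
Definition seq_max (s : seq rat) : rat := \big[Num.max/head 0 s]_(x <- s) x.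
Definition seq_min (s : seq rat) : rat := \big[Num.min/head 0 s]_(x <- s) x.

Fixpoint stop (left_first : bool) (G : game) : rat :=
  if number_value G is Some x then x else
  let: Game L R := G in
  if left_first then seq_max [seq stop false g | g <- L]
  else seq_min [seq stop true g | g <- R].

Definition left_stop (G : game) : rat := stop true G.
Definition right_stop (G : game) : rat := stop false G.

Definition least_nonneg_dyadic (P : rat -> Prop) (p : rat) : Prop :=
  [/\ dyadic p, 0 <= p, P p
    & forall q : rat, dyadic q -> 0 <= q -> P q -> p <= q].

(* [taxed q] is the expression {(G^L)_q - q | (G^R)_q + q}, with which G_q
   coincides up to q = tau; hence tau is the least q at which the stops of
   [taxed q] agree. *)
Fixpoint penalized (G : game) (p : rat) : game :=
  let: Game L R := G in
  let taxed (q : rat) :=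
    Game [seq gadd (penalized g q) (number_game (- q)) | g <- L]
         [seq gadd (penalized g q) (number_game q) | g <- R] in
  let is_tau :=
    least_nonneg_dyadic (fun q => left_stop (taxed q) = right_stop (taxed q)) in
  if pselect (exists tau, is_tau tau /\ tau < p) is left h
  then number_game (left_stop (taxed (projT1 (cid h))))
  else taxed p.

Definition is_temperature (G : game) (t : rat) : Prop :=
  (exists (k : int) (n : nat),
     [/\ (0 < n)%N -> ~~ (2 %| k)%Z,
         geqv G (number_game (k%:~R / 2 ^+ n))
       & t = - (1 / 2 ^+ n)])
  \/
  (~ (exists x, equals_dyadic G x) /\
   exists2 C, canonical_form G C
     & least_nonneg_dyadic
         (fun p => left_stop (penalized C p) = right_stop (penalized C p)) t).

Definition hot (G : game) : Prop := exists2 t, is_temperature G t & 0 < t.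

Definition is_mean_value (G : game) (m : rat) : Prop :=
  dyadic m /\
  forall eps : rat, dyadic eps -> 0 < eps ->
    exists N0 : nat, forall N : nat, (N0 <= N)%N ->
      gle (gmuln N (number_game (m - eps))) (gmuln N G) &&
      gle (gmuln N G) (gmuln N (number_game (m + eps))).

(* [d] bounds the depth of the recursion; any d >= n gives the
   same game. *)
Fixpoint robin_hood_rec (d n a b : nat) : game :=
  if d is d'.+1 then
    Game [seq robin_hood_rec d' (n - i)%N a (b - i)%N | i <- iota 1%N (minn n a)]
         [seq robin_hood_rec d' (n - j)%N (a - j)%N b | j <- iota 1%N (minn n b)]
  else gzero.

Definition robin_hood (n a b : nat) : game := robin_hood_rec n n a b.

Lemma robin_hood_rec_enough d n a b :
  (n <= d)%N -> robin_hood_rec d n a b = robin_hood n a b.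
Proof.
rewrite /robin_hood.
suff H d1 d2 m x y : (m <= d1)%N -> (m <= d2)%N ->
    robin_hood_rec d1 m x y = robin_hood_rec d2 m x y by move=> /H; apply.
elim: d1 d2 m x y => [|d1 IH] [|d2] m x y //=.
- by rewrite leqn0 => /eqP -> _; rewrite !min0n.
- by move=> _; rewrite leqn0 => /eqP ->; rewrite !min0n.
move=> m1 m2; congr Game; apply/eq_in_map => i; rewrite mem_iota => /andP[i0 _];
  by apply: IH; rewrite leq_subLR (leq_trans _ (leq_add i0 (leqnn _))).
Qed.

Lemma robin_hoodE n a b :
  robin_hood n a b =
  Game [seq robin_hood (n - i) a (b - i) | i <- iota 1%N (minn n a)]
       [seq robin_hood (n - j) (a - j) b | j <- iota 1%N (minn n b)].
Proof.
case: n => [|n]; first by rewrite !min0n.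
congr Game; apply/eq_in_map => i; rewrite mem_iota => /andP[i0 _];
  by apply: robin_hood_rec_enough; rewrite leq_subLR (leq_add i0 (leqnn _)).
Qed.

Definition phi (R : realType) : R := (1 + Num.sqrt 5) / 2.

Definition pingala (a b : nat) (U : nat -> nat) : Prop :=
  [/\ forall k, (0 < U k)%N,
      (U 1 <= U 0)%N,
      forall k, U k.+2 = (U k.+1 + U k)%N
    & exists q : nat, U q = minn a b /\ U q.+1 = maxn a b].

(* Main.v *)
Require Import Defs.
From HB Require Import structures.
From mathcomp Require Import all_boot all_order all_algebra.
From mathcomp Require Import boolp reals.
From mathcomp Require Import zify ring lra.

Set Implicit Arguments.
Unset Strict Implicit.
Unset Printing Implicit Defensive.

Import Order.TTheory GRing.Theory Num.Theory.
Local Open Scope ring_scope.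

(** The theorem is read off from thermographs. For a game [G] and a tax [p], the
    Left and Right walls are the stops of the penalized game; they approach each
    other as [p] grows, and once they meet they stay together along a mast. The
    tax at which they meet is the temperature, unless the game is a number, and
    the position of the mast is the mean value. So for each position it suffices
    to locate the point where the walls meet ([temperature_and_mean]).

    Four facts about arbitrary short games make this legitimate. The walls are
    affine with integer slopes on the cells of a binary grid, so they first meet
    at a dyadic tax ([thermograph_exists]). They respect the order of games
    ([walls_le]), so they can be computed on the position itself although the
    temperature is defined through its canonical form, which exists because a
    smallest game among its equals is canonical ([smallest_canonical]). The
    thermostrat strategy shows that the mast is the mean value
    ([mean_value_mast]). Underneath lies the description of stops as cuts in the
    dyadic line ([stop_cut]), which makes them invariant under equality and
    compatible with the translation by a number.

    For Robin Hood, let [a < b], so that Left is the poorer player. Right can ruin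
    Left at once, which leaves Right [n - a] moves. Left's best move is to steal
    [a]: it turns [(n; a, b)] into [(n - a; a, b - a)], which is, with the players
    exchanged, one step down the Pingala sequence through [a] and [b]. Hence the
    positions [(n; U_k, U_(k+1))] are treated by induction on [k], in steps of
    two. At an odd index [k] Left's theft is a threat that Right must answer
    at every tax below [U_(k+1) - U_0]; Left moves with sente, and the mast stands
    at [- (n - U_(k+2) + U_0)] ([freezes_odd]). At an even index [k >= 2] the
    theft wins the race, and at high taxes the position behaves like the switch
    between [n - U_(k+2) + U_0] and [- (n - U_k)], whose temperature grows with
    [n] ([freezes_even]). When [a = b] both players threaten ruin
    ([freezes_equal]). Thefts other than [a] are no better, by the monotonicity of
    positions in the two wealths ([reply_equalize]). The parity of the index of
    [a] tells on which side of [phi] the ratio [b / a] lies ([phi_alternates]),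
    and exchanging the players negates the game, which gives the case [b < a].
    Hotness needs less: already the stops differ once [n >= a + b]
    ([stops_apart]). *)

(** * Games as a preordered group *)

HB.instance Definition _ := gen_eqMixin game.

Fixpoint gsize (G : game) : nat :=
  let: Game L R := G in
  (sumn [seq gsize g | g <- L] + sumn [seq gsize g | g <- R]).+1.

Lemma leq_sumn_map (T : eqType) (f : T -> nat) (s : seq T) x :
  x \in s -> (f x <= sumn [seq f y | y <- s])%N.
Proof.
elim: s => //= y s IH; rewrite in_cons => /orP[/eqP -> | /IH]; first exact: leq_addr.
by move=> /leq_trans; apply; exact: leq_addl.
Qed.

Lemma gsize_left G g : g \in left_options G -> (gsize g < gsize G)%N.
Proof. by case: G => L R /(leq_sumn_map gsize) le_g; rewrite ltnS (leq_trans le_g) ?leq_addr. Qed.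

Lemma gsize_right G g : g \in right_options G -> (gsize g < gsize G)%N.
Proof. by case: G => L R /(leq_sumn_map gsize) le_g; rewrite ltnS (leq_trans le_g) ?leq_addl. Qed.

Lemma game_options_ind (P : game -> Prop) :
  (forall G, {in left_options G, forall g, P g} ->
             {in right_options G, forall g, P g} -> P G) ->
  forall G, P G.
Proof.
move=> IH G; have [m] := ubnP (gsize G); elim: m G => // m IHm G lt_m.
by apply: IH => g gin; apply: IHm;
   [have := gsize_left gin | have := gsize_right gin]; lia.
Qed.

Lemma left_options_add G H :
  left_options (gadd G H) =
  [seq gadd g H | g <- left_options G] ++ [seq gadd G h | h <- left_options H].
Proof. by case: G H => GL GR [HL HR]. Qed.

Lemma right_options_add G H :
  right_options (gadd G H) =
  [seq gadd g H | g <- right_options G] ++ [seq gadd G h | h <- right_options H].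
Proof. by case: G H => GL GR [HL HR]. Qed.

Lemma left_addl G H g : g \in left_options G -> gadd g H \in left_options (gadd G H).
Proof. by move=> gin; rewrite left_options_add mem_cat (map_f (gadd^~ H) gin). Qed.

Lemma left_addr G H h : h \in left_options H -> gadd G h \in left_options (gadd G H).
Proof. by move=> hin; rewrite left_options_add mem_cat orbC (map_f (gadd G) hin). Qed.

Lemma right_addl G H g : g \in right_options G -> gadd g H \in right_options (gadd G H).
Proof. by move=> gin; rewrite right_options_add mem_cat (map_f (gadd^~ H) gin). Qed.

Lemma right_addr G H h : h \in right_options H -> gadd G h \in right_options (gadd G H).
Proof. by move=> hin; rewrite right_options_add mem_cat orbC (map_f (gadd G) hin). Qed.

Lemma left_add_inv G H (P : game -> Prop) :
  {in left_options G, forall g, P (gadd g H)} ->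
  {in left_options H, forall h, P (gadd G h)} ->
  {in left_options (gadd G H), forall x, P x}.
Proof.
move=> PG PH x; rewrite left_options_add mem_cat => /orP[] /mapP[y yin ->]; auto.
Qed.

Lemma right_add_inv G H (P : game -> Prop) :
  {in right_options G, forall g, P (gadd g H)} ->
  {in right_options H, forall h, P (gadd G h)} ->
  {in right_options (gadd G H), forall x, P x}.
Proof.
move=> PG PH x; rewrite right_options_add mem_cat => /orP[] /mapP[y yin ->]; auto.
Qed.

Lemma left_options_opp G :
  left_options (gopp G) = [seq gopp g | g <- right_options G].
Proof. by case: G. Qed.

Lemma right_options_opp G :
  right_options (gopp G) = [seq gopp g | g <- left_options G].
Proof. by case: G. Qed.

Lemma game_eq G H : left_options G = left_options H ->
  right_options G = right_options H -> G = H.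
Proof. by case: G H => ? ? [? ?] /= -> ->. Qed.

Lemma left_winsT G : left_wins true G = has (left_wins false) (left_options G).
Proof. by case: G. Qed.

Lemma left_winsF G : left_wins false G = all (left_wins true) (right_options G).
Proof. by case: G. Qed.

Lemma goppK : involutive gopp.
Proof.
elim/game_options_ind => G IHL IHR; apply: game_eq.
  rewrite left_options_opp right_options_opp -map_comp -[RHS]map_id.
  exact/eq_in_map.
rewrite right_options_opp left_options_opp -map_comp -[RHS]map_id.
exact/eq_in_map.
Qed.

Lemma mem_left_opp G g :
  (g \in left_options (gopp G)) = (gopp g \in right_options G).
Proof. by rewrite left_options_opp -[g in LHS]goppK mem_map //; exact: can_inj goppK. Qed.

Lemma mem_right_opp G g :
  (g \in right_options (gopp G)) = (gopp g \in left_options G).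
Proof. by rewrite right_options_opp -[g in LHS]goppK mem_map //; exact: can_inj goppK. Qed.

Lemma gadd0 G : gadd G gzero = G.
Proof.
elim/game_options_ind: G => G IHL IHR; apply: game_eq.
  by rewrite left_options_add cats0 -[RHS]map_id; exact/eq_in_map.
by rewrite right_options_add cats0 -[RHS]map_id; exact/eq_in_map.
Qed.

Lemma add0g G : gadd gzero G = G.
Proof.
elim/game_options_ind: G => G IHL IHR; apply: game_eq.
  by rewrite left_options_add /= -[RHS]map_id; exact/eq_in_map.
by rewrite right_options_add /= -[RHS]map_id; exact/eq_in_map.
Qed.

Lemma gaddA G H K : gadd G (gadd H K) = gadd (gadd G H) K.
Proof.
elim/game_options_ind: G H K => G GL GR; elim/game_options_ind => H HL HR.
elim/game_options_ind => K KL KR; apply: game_eq.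
  rewrite !left_options_add !map_cat -!map_comp -catA.
  by congr (_ ++ (_ ++ _)); apply/eq_in_map => x xin /=;
     [exact: GL | exact: HL | exact: KL].
rewrite !right_options_add !map_cat -!map_comp -catA.
by congr (_ ++ (_ ++ _)); apply/eq_in_map => x xin /=;
   [exact: GR | exact: HR | exact: KR].
Qed.

Lemma goppD G H : gopp (gadd G H) = gadd (gopp G) (gopp H).
Proof.
elim/game_options_ind: G H => G GL GR; elim/game_options_ind => H HL HR.
apply: game_eq.
  rewrite left_options_add !left_options_opp right_options_add map_cat -!map_comp.
  by congr (_ ++ _); apply/eq_in_map => x xin /=; [exact: GR | exact: HR].
rewrite right_options_add !right_options_opp left_options_add map_cat -!map_comp.
by congr (_ ++ _); apply/eq_in_map => x xin /=; [exact: GL | exact: HL].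
Qed.

Lemma left_wins_addC b G H : left_wins b (gadd G H) = left_wins b (gadd H G).
Proof.
elim/game_options_ind: G H b => G GL GR; elim/game_options_ind => H HL HR [].
  rewrite !left_winsT !left_options_add !has_cat orbC !has_map.
  by congr (_ || _); apply: eq_in_has => x xin /=; [exact: HL | exact: GL].
rewrite !left_winsF !right_options_add !all_cat andbC !all_map.
by congr (_ && _); apply: eq_in_all => x xin /=; [exact: HR | exact: GR].
Qed.

Lemma left_wins_opp b G : left_wins b (gopp G) = ~~ left_wins (~~ b) G.
Proof.
elim/game_options_ind: G b => G GL GR [] /=.
  rewrite left_winsT left_winsF left_options_opp has_map -has_predC.
  by apply: eq_in_has => x /GR /= ->.
rewrite left_winsT left_winsF right_options_opp all_map -all_predC.
by apply: eq_in_all => x /GL /= ->.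
Qed.

Lemma left_wins_subT G H : left_wins true (gadd G (gopp H)) = ~~ gle G H.
Proof. by rewrite /gle -[RHS](left_wins_opp true) goppD goppK left_wins_addC. Qed.

(** Conway's recursive description of the order: it turns every later
    argument about who wins a difference into one about options. *)
Lemma gleP G H :
  reflect ({in left_options G, forall g, ~~ gle H g} /\
           {in right_options H, forall h, ~~ gle h G})
          (gle G H).
Proof.
rewrite [gle G H]/gle left_winsF right_options_add all_cat !all_map right_options_opp.
rewrite all_map andbC; apply: (iffP andP) => -[].
  move=> /allP HL /allP HR; split=> g; first by move=> /HL /=; rewrite left_wins_subT.
  by move=> /HR /=; rewrite left_wins_subT.
by move=> HL HR; split; apply/allP => g gin /=; rewrite left_wins_subT; auto.
Qed.

Lemma gle_refl G : gle G G.
Proof.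
elim/game_options_ind: G => G IHL IHR; apply/gleP; split=> g gin; apply/negP.
  by move=> /gleP[/(_ g gin)]; rewrite IHL.
by move=> /gleP[_ /(_ g gin)]; rewrite IHR.
Qed.

Lemma left_lf G g : g \in left_options G -> ~~ gle G g.
Proof. by move=> gin; have /gleP[/(_ g gin)] := gle_refl G. Qed.

Lemma right_lf G g : g \in right_options G -> ~~ gle g G.
Proof. by move=> gin; have /gleP[_ /(_ g gin)] := gle_refl G. Qed.

Lemma gle_trans H G K : gle G H -> gle H K -> gle G K.
Proof.
have [m] := ubnP (gsize G + gsize H + gsize K)%N.
elim: m G H K => // m IH G H K lt_m GH HK; apply/gleP; split=> g gin.
  apply/negP => Kg; have /gleP[/(_ g gin)/negP + _] := GH; apply.
  by apply: IH HK Kg; have := gsize_left gin; lia.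
apply/negP => gG; have /gleP[_ /(_ g gin)/negP +] := HK; apply.
by apply: IH gG GH; have := gsize_right gin; lia.
Qed.

Lemma gle_lf_trans H G K : gle G H -> ~~ gle K H -> ~~ gle K G.
Proof. by move=> GH; apply: contra => /gle_trans; apply. Qed.

Lemma lf_gle_trans H G K : ~~ gle H G -> gle H K -> ~~ gle K G.
Proof. by move=> GH HK; apply: contra GH; exact: gle_trans. Qed.

Lemma gle_options G H :
  {in left_options G, forall g, exists2 h, h \in left_options H & gle g h} ->
  {in right_options H, forall h, exists2 g, g \in right_options G & gle g h} ->
  gle G H.
Proof.
move=> GL HR; apply/gleP; split=> [g /GL[h hin le_gh]|h /HR[g gin le_gh]].
  exact: gle_lf_trans le_gh (left_lf hin).
exact: lf_gle_trans (right_lf gin) le_gh.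
Qed.

Lemma lf_options G H : ~~ gle H G ->
  (exists2 h, h \in left_options H & gle G h) \/
  (exists2 g, g \in right_options G & gle g H).
Proof.
move=> lf_GH; apply: contrapT => no_option; move/negP: lf_GH; apply; apply/gleP.
by split=> x xin; apply/negP => le_x; apply: no_option; [left|right]; exists x.
Qed.

(** Cancellation is part of the induction: if [G^L + K] were at least [H + K],
    then [G^L] would be at least [H]. *)
Lemma gle_add2r K G H : gle (gadd G K) (gadd H K) = gle G H.
Proof.
have [m] := ubnP (gsize G + gsize H + gsize K)%N.
elim: m G H K => // m IH G H K lt_m; apply/idP/idP => le_GH.
  have /gleP[GL GR] := le_GH; apply/gleP; split=> g gin.
    rewrite -(IH _ _ K); last by have := gsize_left gin; lia.
    by apply: GL; exact: left_addl.
  rewrite -(IH _ _ K); last by have := gsize_right gin; lia.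
  by apply: GR; exact: right_addl.
have /gleP[GL GR] := le_GH; apply/gleP; split.
  apply: left_add_inv => x xin.
    by rewrite IH; [exact: GL|have := gsize_left xin; lia].
  apply: gle_lf_trans (left_lf (left_addr H xin)).
  by rewrite IH //; have := gsize_left xin; lia.
apply: right_add_inv => x xin.
  by rewrite IH; [exact: GR|have := gsize_right xin; lia].
apply: lf_gle_trans (right_lf (right_addr G xin)) _.
by rewrite IH //; have := gsize_right xin; lia.
Qed.

Lemma gle_oppC G H : gle (gopp G) (gopp H) = gle H G.
Proof. by rewrite /gle goppK left_wins_addC. Qed.

Lemma gle_addC G H : gle (gadd G H) (gadd H G).
Proof.
have [m] := ubnP (gsize G + gsize H)%N; elim: m G H => // m IH G H lt_m.
apply/gleP; split.
  apply: left_add_inv => x xin.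
    apply: gle_lf_trans (left_lf (left_addr H xin)).
    by apply: IH; have := gsize_left xin; lia.
  apply: gle_lf_trans (left_lf (left_addl G xin)).
  by apply: IH; have := gsize_left xin; lia.
apply: right_add_inv => x xin.
  apply: lf_gle_trans (right_lf (right_addr G xin)) _.
  by apply: IH; have := gsize_right xin; lia.
apply: lf_gle_trans (right_lf (right_addl H xin)) _.
by apply: IH; have := gsize_right xin; lia.
Qed.

Lemma gle_add2l K G H : gle (gadd K G) (gadd K H) = gle G H.
Proof.
apply/idP/idP => le_GH.
  by rewrite -(gle_add2r K); apply: gle_trans (gle_addC _ _) _;
     apply: gle_trans le_GH (gle_addC _ _).
by apply: gle_trans (gle_addC _ _) _; apply: gle_trans (gle_addC _ _);
   rewrite gle_add2r.
Qed.

Lemma gle_add G H G' H' : gle G H -> gle G' H' -> gle (gadd G G') (gadd H H').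
Proof.
by move=> le1 le2; apply: (gle_trans (H := gadd H G')); rewrite ?gle_add2r ?gle_add2l.
Qed.

Lemma geqv_refl G : geqv G G.
Proof. by rewrite /geqv gle_refl. Qed.

Lemma geqv_sym G H : geqv G H = geqv H G.
Proof. by rewrite /geqv andbC. Qed.

Lemma geqv_trans H G K : geqv G H -> geqv H K -> geqv G K.
Proof.
by case/andP=> GH HG /andP[HK KH]; rewrite /geqv (gle_trans GH HK) (gle_trans KH HG).
Qed.

Lemma geqv_lel G H K : geqv G H -> gle G K = gle H K.
Proof. by case/andP=> GH HG; apply/idP/idP; exact: gle_trans. Qed.

Lemma geqv_ler G H K : geqv G H -> gle K G = gle K H.
Proof. by case/andP=> GH HG; apply/idP/idP => /gle_trans; apply. Qed.

Lemma geqv_add G H G' H' : geqv G H -> geqv G' H' -> geqv (gadd G G') (gadd H H').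
Proof. by case/andP=> ? ? /andP[? ?]; rewrite /geqv !gle_add. Qed.

Lemma geqv_opp G H : geqv (gopp G) (gopp H) = geqv G H.
Proof. by rewrite /geqv !gle_oppC andbC. Qed.

(** * Dyadic rationals as games *)

Lemma integer_gameS (m : nat) : integer_game m.+1 = Game [:: integer_game m] [::].
Proof. by []. Qed.

Lemma integer_gameN (m : nat) : integer_game (- m%:Z) = gopp (integer_game m).
Proof.
elim: m => [//|m IH]; rewrite integer_gameS /= -IH.
by case: m {IH}.
Qed.

Lemma integer_game_opp (k : int) : integer_game (- k) = gopp (integer_game k).
Proof.
by case: (intP k) => [//|m|m]; rewrite ?opprK integer_gameN ?goppK.
Qed.

Lemma left_options_integer (k : int) :
  left_options (integer_game k) =
  if 0 < k then [:: integer_game (k - 1)] else [::].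
Proof.
case: (intP k) => [//|m|m]; last by rewrite integer_gameN integer_gameS.
by have -> : m.+1%:Z - 1 = m by lia.
Qed.

Lemma right_options_integer (k : int) :
  right_options (integer_game k) =
  if k < 0 then [:: integer_game (k + 1)] else [::].
Proof.
rewrite -[k in LHS]opprK integer_game_opp right_options_opp left_options_integer.
by rewrite oppr_gt0; case: ifP => //= _; rewrite -integer_game_opp opprD !opprK.
Qed.

Lemma dyadic_game_even n k : dyadic_game n.+1 (2 * k) = dyadic_game n k.
Proof. by rewrite /= dvdz_mulr // mulKz. Qed.

Lemma dyadic_game_odd n k :
  dyadic_game n.+1 (2 * k + 1) = Game [:: dyadic_game n k] [:: dyadic_game n (k + 1)].
Proof.
have -> : dyadic_game n.+1 (2 * k + 1) =
  if (2 %| 2 * k + 1)%Z then dyadic_game n ((2 * k + 1) %/ 2)%Z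
  else Game [:: dyadic_game n ((2 * k + 1 - 1) %/ 2)%Z]
            [:: dyadic_game n ((2 * k + 1 + 1) %/ 2)%Z] by [].
case: ifP => [|_]; first by lia.
by rewrite addrK (_ : 2 * k + 1 + 1 = 2 * (k + 1)) ?mulKz //; ring.
Qed.

Lemma int_parity (k : int) : {j | k = 2 * j} + {j | k = 2 * j + 1}.
Proof.
by case: (boolP (2 %| k)%Z) => k2; [left|right]; exists (k %/ 2)%Z; lia.
Qed.

Lemma dyadic_game_opp n k : dyadic_game n (- k) = gopp (dyadic_game n k).
Proof.
elim: n k => [|n IH] k; first exact: integer_game_opp.
have [[j ->]|[j ->]] := int_parity k; first by rewrite -mulrN !dyadic_game_even.
have -> : - (2 * j + 1) = 2 * (- (j + 1)) + 1 by ring.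
by rewrite !dyadic_game_odd /= -!IH; congr (Game [:: _] [:: dyadic_game _ _]); ring.
Qed.

Lemma dyadic_game_lift m n k : dyadic_game (n + m) (k * 2 ^+ m) = dyadic_game n k.
Proof.
elim: m => [|m IH]; first by rewrite addn0 expr0 mulr1.
by rewrite addnS exprS mulrCA dyadic_game_even.
Qed.

(** A number lies between its options, and increases by one step at each level
    of the binary grid; both are proved together because the first at level
    [n.+1] uses the second at level [n]. *)
Lemma dyadic_game_step n k :
  [/\ {in left_options (dyadic_game n k), forall g, gle g (dyadic_game n k)},
      {in right_options (dyadic_game n k), forall g, gle (dyadic_game n k) g},
      gle (dyadic_game n k) (dyadic_game n (k + 1))
    & ~~ gle (dyadic_game n (k + 1)) (dyadic_game n k)].
Proof.
elim: n k => [|n IH] k.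
  have succ (m : nat) : gle (integer_game m) (integer_game m.+1).
    elim: m => [|m IHm]; first by apply/gleP.
    apply/gleP; split=> // g; rewrite inE => /eqP ->.
    apply: gle_lf_trans IHm _; apply: left_lf; exact: mem_head.
  have step j : gle (integer_game j) (integer_game (j + 1)).
    case: (intP j) => [|m|m]; first exact: (succ 0%N).
      by rewrite -PoszD addn1; exact: succ.
    rewrite -gle_oppC -!integer_game_opp opprK.
    have -> : - (- (m.+1)%:Z + 1) = m by lia.
    exact: succ.
  split=> [g|g||] /=; rewrite ?left_options_integer ?right_options_integer.
  - by case: ifP => // _; rewrite inE => /eqP ->; rewrite -{2}[k](subrK 1) step.
  - by case: ifP => // _; rewrite inE => /eqP ->.
  - exact: step.
  have [k0|k0] := leP 0 k.
    by apply: left_lf; rewrite left_options_integer ltzD1 k0 addrK mem_head.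
  by apply: right_lf; rewrite right_options_integer k0 mem_head.
have between j :
  gle (dyadic_game n j) (dyadic_game n.+1 (2 * j + 1)) /\
  gle (dyadic_game n.+1 (2 * j + 1)) (dyadic_game n (j + 1)).
  have [Lj Rj lej ltj] := IH j; have [Lj1 Rj1 _ _] := IH (j + 1).
  rewrite dyadic_game_odd; split; apply/gleP; split=> g /=.
  - move=> gin; apply: gle_lf_trans (Lj g gin) _.
    by apply: left_lf; exact: mem_head.
  - by rewrite inE => /eqP ->.
  - by rewrite inE => /eqP ->.
  - move=> gin; apply: lf_gle_trans _ (Rj1 g gin).
    by apply: right_lf; exact: mem_head.
have [[j ->]|[j ->]] := int_parity k.
  have [Lj Rj lej ltj] := IH j; rewrite dyadic_game_even; split=> //.
    by have [] := between j.
  by rewrite dyadic_game_odd; apply: left_lf; exact: mem_head.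
have [le1 le2] := between j.
have -> : 2 * j + 1 + 1 = 2 * (j + 1) by ring.
rewrite dyadic_game_even dyadic_game_odd; split=> //.
- by move=> g; rewrite inE => /eqP ->; rewrite -dyadic_game_odd.
- by move=> g; rewrite inE => /eqP ->; rewrite -dyadic_game_odd.
- by rewrite -dyadic_game_odd.
by apply: right_lf; exact: mem_head.
Qed.

Lemma dyadic_game_le n k l : gle (dyadic_game n k) (dyadic_game n l) = (k <= l).
Proof.
have mono (a : int) (d : nat) : gle (dyadic_game n a) (dyadic_game n (a + d%:Z)).
  elim: d => [|d IH]; first by rewrite addr0 gle_refl.
  rewrite -addn1 PoszD addrA; apply: gle_trans IH _.
  by have [] := dyadic_game_step n (a + d%:Z).
have mono' a c : a <= c -> gle (dyadic_game n a) (dyadic_game n c).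
  by move=> le_ac; rewrite (_ : c = a + `|c - a|%N%:Z) ?mono //; lia.
apply/idP/idP => [|/mono' //]; apply: contraLR; rewrite -ltNge -lezD1 => /mono' le_lk.
by have [_ _ _ lt_l] := dyadic_game_step n l; exact: lf_gle_trans lt_l le_lk.
Qed.

Lemma dyadic_game_left n k g : g \in left_options (dyadic_game n k) ->
  exists2 j, g = dyadic_game n j & j < k.
Proof.
elim: n k => [|n IH] k.
  rewrite /= left_options_integer; case: ifP => // _; rewrite inE => /eqP ->.
  by exists (k - 1) => //; lia.
have [[j ->]|[j ->]] := int_parity k.
  rewrite dyadic_game_even => /IH[i -> lt_ij]; exists (2 * i); last by lia.
  by rewrite dyadic_game_even.
rewrite dyadic_game_odd inE => /eqP ->; exists (2 * j); last by lia.
by rewrite dyadic_game_even.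
Qed.

Lemma dyadic_game_right n k g : g \in right_options (dyadic_game n k) ->
  exists2 j, g = dyadic_game n j & k < j.
Proof.
rewrite -[g]goppK -mem_left_opp -dyadic_game_opp => /dyadic_game_left[j gE lt_j].
by exists (- j); [rewrite dyadic_game_opp gE|lia].
Qed.

(** A Right move in the sum [k + l] can be matched, at no greater cost, by a
    Right move in one of the two terms: the term whose denominator is at
    least that of the sum, or a negative term when both are integers. *)
Lemma dyadic_game_right_add n k l g : g \in right_options (dyadic_game n (k + l)) ->
  exists2 z, g = dyadic_game n z &
    (exists2 j, dyadic_game n j \in right_options (dyadic_game n k) & j + l <= z) \/
    (exists2 j, dyadic_game n j \in right_options (dyadic_game n l) & k + j <= z).
Proof.
elim: n k l g => [|n IH] k l g.
  rewrite /= right_options_integer; case: ifP => // kl0; rewrite inE => /eqP ->.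
  exists (k + l + 1) => //; have [k0|k0] := ltP k 0.
    by left; exists (k + 1); rewrite ?right_options_integer ?k0 ?mem_head //; lia.
  right; exists (l + 1); last by lia.
  by rewrite right_options_integer; case: ltP; rewrite ?mem_head //; lia.
have odd_right j : dyadic_game n.+1 (2 * j + 1 + 1) \in
    right_options (dyadic_game n.+1 (2 * j + 1)).
  rewrite (_ : _ + 1 + 1 = 2 * (j + 1)); last by ring.
  by rewrite dyadic_game_odd dyadic_game_even mem_head.
have [[i ->]|[i ->]] := int_parity k; have [[j ->]|[j ->]] := int_parity l.
- rewrite -mulrDr dyadic_game_even => /IH[z -> zP]; exists (2 * z).
    by rewrite dyadic_game_even.
  case: zP => -[j' j'in le_z]; [left|right]; exists (2 * j'); rewrite ?dyadic_game_even //; lia.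
- move=> /dyadic_game_right[z -> lt_z]; exists z => //.
  by right; exists (2 * j + 1 + 1); [exact: odd_right|lia].
- move=> /dyadic_game_right[z -> lt_z]; exists z => //.
  by left; exists (2 * i + 1 + 1); [exact: odd_right|lia].
- move=> /dyadic_game_right[z -> lt_z]; exists z => //.
  by left; exists (2 * i + 1 + 1); [exact: odd_right|lia].
Qed.

(** Only one inequality is needed: it passes through the induction by itself,
    and the other one is its negative. *)
Lemma dyadic_game_add_le n k l :
  gle (gadd (dyadic_game n k) (dyadic_game n l)) (dyadic_game n (k + l)).
Proof.
have [m] := ubnP (gsize (dyadic_game n k) + gsize (dyadic_game n l))%N.
elim: m k l => // m IH k l lt_m; apply/gleP; split.
  apply: left_add_inv => x xin; have [j xE lt_j] := dyadic_game_left xin;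
    have := gsize_left xin; rewrite xE => lt_x.
    apply: (gle_lf_trans (H := dyadic_game n (j + l))); first by apply: IH; lia.
    by rewrite dyadic_game_le; lia.
  apply: (gle_lf_trans (H := dyadic_game n (k + j))); first by apply: IH; lia.
  by rewrite dyadic_game_le; lia.
move=> g /dyadic_game_right_add[z -> []] [j jin le_z]; have lt_j := gsize_right jin.
  apply: lf_gle_trans (right_lf (right_addl _ jin)) _.
  apply: gle_trans (IH _ _ _) _; first by lia.
  by rewrite dyadic_game_le.
apply: lf_gle_trans (right_lf (right_addr _ jin)) _.
apply: gle_trans (IH _ _ _) _; first by lia.
by rewrite dyadic_game_le.
Qed.

Lemma dyadic_game_add n k l :
  geqv (gadd (dyadic_game n k) (dyadic_game n l)) (dyadic_game n (k + l)).
Proof.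
rewrite /geqv dyadic_game_add_le /= -gle_oppC goppD -!dyadic_game_opp opprD.
exact: dyadic_game_add_le.
Qed.

Lemma expf2_neq0 n : (2 : rat) ^+ n != 0.
Proof. by rewrite expf_neq0. Qed.

Lemma dyadic_common x y : dyadic x -> dyadic y ->
  exists n (k l : int), x = k%:~R / 2 ^+ n /\ y = l%:~R / 2 ^+ n.
Proof.
move=> [k [n ->]] [l [m ->]]; exists (n + m)%N, (k * 2 ^+ m), (l * 2 ^+ n).
have := expf2_neq0 n; have := expf2_neq0 m.
by rewrite !intrM !rmorphXn /= exprD => ? ?; split; field; apply/andP.
Qed.

Lemma dyadic_int (k : int) : dyadic k%:~R.
Proof. by exists k, 0%N; rewrite expr0 divr1. Qed.

Lemma dyadic_nat (k : nat) : dyadic k%:R.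
Proof. exact: (dyadic_int k). Qed.

Lemma dyadicN x : dyadic x -> dyadic (- x).
Proof. by case=> k [n ->]; exists (- k), n; rewrite intrN mulNr. Qed.

Lemma dyadicD x y : dyadic x -> dyadic y -> dyadic (x + y).
Proof.
move=> dx dy; have [n [k [l [-> ->]]]] := dyadic_common dx dy.
by exists (k + l), n; rewrite intrD mulrDl.
Qed.

Lemma dyadicB x y : dyadic x -> dyadic y -> dyadic (x - y).
Proof. by move=> dx dy; exact/dyadicD/dyadicN. Qed.

Lemma dyadic_half x : dyadic x -> dyadic (x / 2).
Proof. by case=> k [n ->]; exists k, n.+1; rewrite exprSr invfM mulrA. Qed.

Lemma dyadic_mid x y : dyadic x -> dyadic y -> dyadic ((x + y) / 2).
Proof. by move=> dx dy; exact/dyadic_half/dyadicD. Qed.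

Lemma dyadic_minr x y : dyadic x -> dyadic y -> dyadic (Num.min x y).
Proof. by move=> dx dy; case: leP. Qed.

Lemma number_game_dyadic n k : number_game (k%:~R / 2 ^+ n) = dyadic_game n k.
Proof.
set x : rat := _ / _; pose d := `|denq x|%N.
have dE : denq x = d by rewrite /d gez0_abs // ltW ?denq_gt0.
have eq_nd : (k * d = numq x * 2 ^+ n)%R.
  apply/eqP; rewrite -(eqr_int rat) !intrM rmorphXn /= -dE.
  have : x * (denq x)%:~R = (numq x)%:~R.
    by rewrite -{1}[x]divq_num_den mulfVK // intr_eq0 denq_neq0.
  by move=> <-; rewrite /x; apply/eqP; field; exact: expf2_neq0.
have : (d %| 2 ^ n)%N.
  have cop : coprime `|numq x| d := coprime_num_den x.
  have := congr1 absz eq_nd; rewrite !abszM abszX /= => eq_abs.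
  rewrite -(@Gauss_dvdr _ `|numq x|) 1?coprime_sym //.
  by rewrite -eq_abs dvdn_mull.
move=> /dvdn_pfactor -/(_ isT)[m le_mn dm].
rewrite /number_game -/x -/d dm pfactorK //.
rewrite -[in RHS](subnKC le_mn) (_ : k = numq x * 2 ^+ (n - m)) ?dyadic_game_lift //.
apply: (@mulIf _ (d%:Z)); first by rewrite dm; lia.
rewrite eq_nd -mulrA; congr (_ * _); rewrite dm -[in LHS](subnK le_mn) exprD.
by rewrite -[(2 ^ m)%N%:Z]natz natrX.
Qed.

Lemma number_game_le x y : dyadic x -> dyadic y ->
  gle (number_game x) (number_game y) = (x <= y).
Proof.
move=> dx dy; have [n [k [l [-> ->]]]] := dyadic_common dx dy.
rewrite !number_game_dyadic dyadic_game_le ler_pM2r ?ler_int //.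
by rewrite invr_gt0 exprn_gt0.
Qed.

Lemma number_game_add x y : dyadic x -> dyadic y ->
  geqv (gadd (number_game x) (number_game y)) (number_game (x + y)).
Proof.
move=> dx dy; have [n [k [l [-> ->]]]] := dyadic_common dx dy.
by rewrite -mulrDl -intrD !number_game_dyadic dyadic_game_add.
Qed.

Lemma number_game_opp x : number_game (- x) = gopp (number_game x).
Proof. by rewrite /number_game denqN numqN dyadic_game_opp. Qed.

Lemma number_game_int (k : int) : number_game k%:~R = integer_game k.
Proof. by rewrite -[k%:~R]divr1 -(expr0 2) number_game_dyadic. Qed.

Lemma number_game_left x g : dyadic x -> g \in left_options (number_game x) ->
  exists y, [/\ g = number_game y, dyadic y & y < x].
Proof.
case=> k [n ->]; rewrite number_game_dyadic => /dyadic_game_left[j -> lt_jk].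
exists (j%:~R / 2 ^+ n); split; rewrite ?number_game_dyadic //; first by exists j, n.
by rewrite ltr_pM2r ?ltr_int // invr_gt0 exprn_gt0.
Qed.

Lemma number_game_right x g : dyadic x -> g \in right_options (number_game x) ->
  exists y, [/\ g = number_game y, dyadic y & x < y].
Proof.
rewrite -[g]goppK -mem_left_opp -number_game_opp => dx.
move=> /(number_game_left (dyadicN dx))[y [gE dy lt_y]].
exists (- y); split; [by rewrite number_game_opp gE| exact: dyadicN |].
by rewrite ltrNr.
Qed.

(** Simplicity: if [x] fits but [G] is not [x], then an option of [x] fits, so
    descending the options of [x] ends at a number equal to [G]. *)
Lemma simplest_number G x : dyadic x ->
  {in left_options G, forall g, ~~ gle (number_game x) g} ->
  {in right_options G, forall g, ~~ gle g (number_game x)} ->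
  exists y, equals_dyadic G y.
Proof.
have [m] := ubnP (gsize (number_game x)); elim: m x => // m IH x lt_m dx GL GR.
have [le_Gx|nle_Gx] := boolP (gle G (number_game x)); last first.
  have /existsNP[y /not_implyP[yin /negP]] : ~ {in right_options (number_game x),
      forall y, ~~ gle y G}.
    by move=> xR; move/negP: nle_Gx; apply; apply/gleP.
  rewrite negbK; have [z [yE dz lt_xz]] := number_game_right dx yin; subst y => le_zG.
  apply: (IH z) => //; first by have := gsize_right yin; lia.
    move=> g gin; apply: lf_gle_trans (GL g gin) _.
    by rewrite number_game_le // ltW.
  by move=> g gin; apply: gle_lf_trans le_zG (right_lf gin).
have [le_xG|nle_xG] := boolP (gle (number_game x) G).
  by exists x; split => //; apply/andP.
have /existsNP[y /not_implyP[yin /negP]] : ~ {in left_options (number_game x),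
    forall y, ~~ gle G y}.
  by move=> xR; move/negP: nle_xG; apply; apply/gleP.
rewrite negbK; have [z [yE dz lt_xz]] := number_game_left dx yin; subst y => le_zG.
apply: (IH z) => //; first by have := gsize_left yin; lia.
  by move=> g gin; apply: lf_gle_trans (left_lf gin) le_zG.
move=> g gin; apply: gle_lf_trans _ (GR g gin).
by rewrite number_game_le // ltW.
Qed.

(** * Stops *)

Definition is_number (G : game) : Prop := exists x, equals_dyadic G x.

Lemma equals_dyadic_inj G x y : equals_dyadic G x -> equals_dyadic G y -> x = y.
Proof.
move=> [dx /andP[Gx xG]] [dy /andP[Gy yG]]; apply: le_anti.
by rewrite -!number_game_le // (gle_trans xG Gy) (gle_trans yG Gx).
Qed.

Lemma number_value_eq G x : equals_dyadic G x -> number_value G = Some x.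
Proof.
move=> Gx; rewrite /number_value; case: pselect => [h|[]]; last by exists x.
by congr Some; exact: equals_dyadic_inj (projT2 (cid h)) Gx.
Qed.

Lemma number_value_none G : ~ is_number G -> number_value G = None.
Proof. by rewrite /number_value; case: pselect. Qed.

Lemma stop_number b G x : equals_dyadic G x -> stop b G = x.
Proof. by move=> Gx; case: G Gx => L R Gx; rewrite /= (number_value_eq Gx). Qed.

Lemma left_stop_options G : ~ is_number G ->
  left_stop G = seq_max [seq right_stop g | g <- left_options G].
Proof. by move=> nG; case: G nG => L R nG; rewrite /left_stop /= number_value_none. Qed.

Lemma right_stop_options G : ~ is_number G ->
  right_stop G = seq_min [seq left_stop g | g <- right_options G].
Proof. by move=> nG; case: G nG => L R nG; rewrite /right_stop /= number_value_none. Qed.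

Lemma seq_max_spec (s : seq rat) : s != [::] ->
  seq_max s \in s /\ {in s, forall x, x <= seq_max s}.
Proof.
case: s => // h s _; rewrite /seq_max /= big_cons.
suff [memM leM] : \big[Num.max/h]_(x <- s) x \in h :: s /\
    {in h :: s, forall x, x <= \big[Num.max/h]_(x <- s) x}.
  by rewrite (max_idPr (leM h (mem_head _ _))).
elim: s => [|y s [memM leM]]; first by rewrite big_nil; split=> [|x];
  rewrite inE // => /eqP ->.
rewrite big_cons; split=> [|x].
  move: memM; rewrite !inE => /orP[] memM; case: leP => _;
    by rewrite ?eqxx ?memM ?orbT.
rewrite !inE le_max => /or3P[/eqP ->|/eqP ->|xs].
- by rewrite leM ?mem_head ?orbT.
- by rewrite lexx.
- by rewrite leM ?orbT // inE xs orbT.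
Qed.

Lemma seq_min_spec (s : seq rat) : s != [::] ->
  seq_min s \in s /\ {in s, forall x, seq_min s <= x}.
Proof.
case: s => // h s _; rewrite /seq_min /= big_cons.
suff [memM leM] : \big[Num.min/h]_(x <- s) x \in h :: s /\
    {in h :: s, forall x, \big[Num.min/h]_(x <- s) x <= x}.
  by rewrite (min_idPr (leM h (mem_head _ _))).
elim: s => [|y s [memM leM]]; first by rewrite big_nil; split=> [|x];
  rewrite inE // => /eqP ->.
rewrite big_cons; split=> [|x].
  move: memM; rewrite !inE => /orP[] memM; case: leP => _;
    by rewrite ?eqxx ?memM ?orbT.
rewrite !inE ge_min => /or3P[/eqP ->|/eqP ->|xs].
- by rewrite leM ?mem_head ?orbT.
- by rewrite lexx.
- by rewrite leM ?orbT // inE xs orbT.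
Qed.

Lemma dyadic_below (s : seq rat) : {in s, forall y, dyadic y} ->
  exists2 x, dyadic x & {in s, forall y, x < y}.
Proof.
elim: s => [|y s IH] ds; first by exists 0; first exact: (dyadic_int 0).
have [x dx lt_x] : exists2 x, dyadic x & {in s, forall y, x < y}.
  by apply: IH => z zs; apply: ds; rewrite inE zs orbT.
have dy : dyadic y by apply: ds; exact: mem_head.
exists (Num.min x y - 1); first exact/dyadicB/(dyadic_int 1)/dyadic_minr.
have lt1 (z : rat) : z - 1 < z by rewrite ltrBlDr ltrDl.
move=> z; rewrite inE => /orP[/eqP ->|zs]; apply: lt_le_trans (lt1 _) _.
  by rewrite ge_min lexx orbT.
by rewrite ge_min ltW ?lt_x.
Qed.

Lemma dyadic_above (s : seq rat) : {in s, forall y, dyadic y} ->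
  exists2 x, dyadic x & {in s, forall y, y < x}.
Proof.
move=> ds; have [|x dx lt_x] := @dyadic_below [seq - y | y <- s].
  by move=> _ /mapP[y ys ->]; exact/dyadicN/ds.
exists (- x); first exact: dyadicN.
by move=> y ys; rewrite ltrNr; apply: lt_x; exact: map_f.
Qed.

Definition is_left_stop (G : game) (l : rat) : Prop :=
  dyadic l /\ forall x, dyadic x ->
    (x < l -> ~~ gle G (number_game x)) /\ (l < x -> gle G (number_game x)).

Definition is_right_stop (G : game) (r : rat) : Prop :=
  dyadic r /\ forall x, dyadic x ->
    (x < r -> gle (number_game x) G) /\ (r < x -> ~~ gle (number_game x) G).

(** A game that is not a number has moves for both players: a missing option
    list would leave room for a number between the options. *)
Lemma options_of_hot G :
  {in left_options G, forall g, is_right_stop g (right_stop g)} ->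
  {in right_options G, forall g, is_left_stop g (left_stop g)} ->
  ~ is_number G -> left_options G != [::] /\ right_options G != [::].
Proof.
move=> GL GR nG; split; apply/eqP => G0; apply: nG.
  have [|x dx lt_x] := @dyadic_below [seq left_stop g | g <- right_options G].
    by move=> _ /mapP[g /GR[] + _ ->].
  apply: (simplest_number dx) => g gin; first by rewrite G0 in gin.
  have [_ /(_ x dx)[+ _]] := GR g gin; apply; apply: lt_x; exact: map_f.
have [|x dx lt_x] := @dyadic_above [seq right_stop g | g <- left_options G].
  by move=> _ /mapP[g /GL[] + _ ->].
apply: (simplest_number dx) => g gin; last by rewrite G0 in gin.
have [_ /(_ x dx)[_ +]] := GL g gin; apply; apply: lt_x; exact: map_f.
Qed.

(** Number avoidance: if [G] is not a number, moves in the number [x] do not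
    help in [G - x], so the winner is decided by the options of [G]. Hence the
    stops are cuts in the dyadic line and depend on the value of [G] only. *)
Lemma stop_cut G : is_left_stop G (left_stop G) /\ is_right_stop G (right_stop G).
Proof.
elim/game_options_ind: G => G IHL IHR.
have [[z Gz]|nG] := pselect (is_number G).
  rewrite /left_stop /right_stop !(stop_number _ Gz); have [dz /andP[le_Gz le_zG]] := Gz.
  split; split=> // x dx; split=> lt_x.
  - by apply: lf_gle_trans _ le_zG; rewrite number_game_le // -ltNge.
  - by apply: gle_trans le_Gz _; rewrite number_game_le // ltW.
  - by apply: gle_trans le_zG; rewrite number_game_le // ltW.
  - by apply: gle_lf_trans le_Gz _; rewrite number_game_le // -ltNge.
have [L0 R0] : left_options G != [::] /\ right_options G != [::].
  by apply: options_of_hot nG => [g /IHL[]|g /IHR[]].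
have [|/mapP[g gin lE] leL] :=
    @seq_max_spec [seq right_stop g | g <- left_options G].
  by case: (left_options G) L0.
have [|/mapP[h hin rE] leR] :=
    @seq_min_spec [seq left_stop g | g <- right_options G].
  by case: (right_options G) R0.
have [_ [dg cutg]] := IHL g gin; have [[dh cuth] _] := IHR h hin.
rewrite left_stop_options // right_stop_options //.
split; split; rewrite ?lE ?rE // => x dx; split=> lt_x.
- apply: gle_lf_trans _ (left_lf gin).
  by have [+ _] := cutg x dx; apply.
(* What remains against [G <= x] is a Right option [z] of [x] with [z <= G]; by
   induction on [x] also [G <= z], and [G] would be the number [z]. *)
- have [m] := ubnP (gsize (number_game x)); elim: m x dx lt_x => // m IH x dx lt_x lt_m.
  apply/gleP; split=> [k kin|y yin].
    have [_ [_ /(_ x dx)[_]]] := IHL k kin; apply; apply: le_lt_trans lt_x.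
    by rewrite -lE; apply: leL; exact: map_f.
  have [z [yE dz lt_xz]] := number_game_right dx yin; subst y.
  apply/negP => le_zG; apply: nG; exists z; split=> //; rewrite /geqv le_zG andbT.
  apply: IH => //; first exact: lt_trans lt_xz.
  by have := gsize_right yin; lia.
- have [m] := ubnP (gsize (number_game x)); elim: m x dx lt_x => // m IH x dx lt_x lt_m.
  apply/gleP; split=> [y yin|k kin].
    have [z [yE dz lt_xz]] := number_game_left dx yin; subst y.
    apply/negP => le_zG; apply: nG; exists z; split=> //; rewrite /geqv le_zG /=.
    apply: IH => //; first exact: lt_trans lt_x.
    by have := gsize_left yin; lia.
  have [[_ /(_ x dx)[+ _]] _] := IHR k kin; apply; apply: lt_le_trans lt_x _.
  by rewrite -rE; apply: leR; exact: map_f.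
- apply: lf_gle_trans (right_lf hin) _.
  by have [_ +] := cuth x dx; apply.
Qed.

Lemma left_stop_dyadic G : dyadic (left_stop G).
Proof. by have [[]] := stop_cut G. Qed.

Lemma right_stop_dyadic G : dyadic (right_stop G).
Proof. by have [_ []] := stop_cut G. Qed.

Lemma lt_left_stop G x : dyadic x -> x < left_stop G -> ~~ gle G (number_game x).
Proof. by move=> dx; have [[_ /(_ x dx)[]]] := stop_cut G. Qed.

Lemma gt_left_stop G x : dyadic x -> left_stop G < x -> gle G (number_game x).
Proof. by move=> dx; have [[_ /(_ x dx)[]]] := stop_cut G. Qed.

Lemma lt_right_stop G x : dyadic x -> x < right_stop G -> gle (number_game x) G.
Proof. by move=> dx; have [_ [_ /(_ x dx)[]]] := stop_cut G. Qed.

Lemma gt_right_stop G x : dyadic x -> right_stop G < x -> ~~ gle (number_game x) G.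
Proof. by move=> dx; have [_ [_ /(_ x dx)[]]] := stop_cut G. Qed.

Lemma mid_between (x y : rat) : x < y -> (x < (x + y) / 2) /\ ((x + y) / 2 < y).
Proof. by move=> lt_xy; split; lra. Qed.

Lemma left_stop_le G H : gle G H -> left_stop G <= left_stop H.
Proof.
move=> le_GH; rewrite leNgt; apply/negP => /mid_between[lt1 lt2].
have dx := dyadic_mid (left_stop_dyadic H) (left_stop_dyadic G).
have /negP := lt_left_stop dx lt2; apply; apply: gle_trans le_GH _.
exact: gt_left_stop.
Qed.

Lemma right_stop_le G H : gle G H -> right_stop G <= right_stop H.
Proof.
move=> le_GH; rewrite leNgt; apply/negP => /mid_between[lt1 lt2].
have dx := dyadic_mid (right_stop_dyadic H) (right_stop_dyadic G).
have /negP := gt_right_stop dx lt1; apply; apply: gle_trans le_GH.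
exact: lt_right_stop.
Qed.

Lemma left_stop_eqv G H : geqv G H -> left_stop G = left_stop H.
Proof. by move=> /andP[? ?]; apply: le_anti; rewrite !left_stop_le. Qed.

Lemma right_stop_eqv G H : geqv G H -> right_stop G = right_stop H.
Proof. by move=> /andP[? ?]; apply: le_anti; rewrite !right_stop_le. Qed.

Lemma right_stop_left_stop G : right_stop G <= left_stop G.
Proof.
rewrite leNgt; apply/negP => /mid_between[]; set x := (_ / 2) => lt1 lt2.
have dx : dyadic x := dyadic_mid (left_stop_dyadic G) (right_stop_dyadic G).
have dy : dyadic ((left_stop G + x) / 2) := dyadic_mid (left_stop_dyadic G) dx.
have le1 : gle G (number_game ((left_stop G + x) / 2)) by apply: gt_left_stop => //; lra.
have := gle_trans (lt_right_stop dx lt2) le1.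
by rewrite number_game_le //; lra.
Qed.

Lemma left_option_stop G g : g \in left_options G -> right_stop g <= left_stop G.
Proof.
move=> gin; rewrite leNgt; apply/negP => /mid_between[lt1 lt2].
have dx := dyadic_mid (left_stop_dyadic G) (right_stop_dyadic g).
have /negP := left_lf gin; apply.
by apply: gle_trans (gt_left_stop dx lt1) _; exact: lt_right_stop.
Qed.

Lemma right_option_stop G g : g \in right_options G -> right_stop G <= left_stop g.
Proof.
move=> gin; rewrite leNgt; apply/negP => /mid_between[lt1 lt2].
have dx := dyadic_mid (left_stop_dyadic g) (right_stop_dyadic G).
have /negP := right_lf gin; apply.
by apply: gle_trans (gt_left_stop dx lt1) _; exact: lt_right_stop.
Qed.

Lemma hot_options G : ~ is_number G -> left_options G != [::] /\ right_options G != [::].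
Proof.
by move=> nG; apply: options_of_hot nG => g _; have [] := stop_cut g.
Qed.

Lemma left_stop_attained G : ~ is_number G ->
  exists2 g, g \in left_options G & left_stop G = right_stop g.
Proof.
move=> nG; have [L0 _] := hot_options nG; rewrite left_stop_options //.
have [|/mapP[g gin ->] _] := @seq_max_spec [seq right_stop g | g <- left_options G].
  by case: (left_options G) L0.
by exists g.
Qed.

Lemma right_stop_attained G : ~ is_number G ->
  exists2 g, g \in right_options G & right_stop G = left_stop g.
Proof.
move=> nG; have [_ R0] := hot_options nG; rewrite right_stop_options //.
have [|/mapP[g gin ->] _] := @seq_min_spec [seq left_stop g | g <- right_options G].
  by case: (right_options G) R0.
by exists g.
Qed.

Lemma stop_gap_not_number G : right_stop G < left_stop G -> ~ is_number G.
Proof.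
by move=> lt_stops [x Gx]; move: lt_stops; rewrite /left_stop /right_stop !(stop_number _ Gx) ltxx.
Qed.

Lemma equals_dyadic_opp G x : equals_dyadic G x -> equals_dyadic (gopp G) (- x).
Proof. by move=> [dx Gx]; split; [exact: dyadicN | rewrite number_game_opp geqv_opp]. Qed.

Lemma equals_dyadic_number x : dyadic x -> equals_dyadic (number_game x) x.
Proof. by move=> dx; split=> //; exact: geqv_refl. Qed.

Lemma left_stop_number x : dyadic x -> left_stop (number_game x) = x.
Proof. by move=> dx; exact/stop_number/equals_dyadic_number. Qed.

Lemma right_stop_number x : dyadic x -> right_stop (number_game x) = x.
Proof. by move=> dx; exact/stop_number/equals_dyadic_number. Qed.

Lemma gle_add_number G x y : dyadic x -> dyadic y ->
  gle (gadd G (number_game y)) (number_game x) = gle G (number_game (x - y)).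
Proof.
move=> dx dy; rewrite -(gle_add2r (number_game y) G); apply: geqv_ler.
rewrite geqv_sym -{2}[x](subrK y); by apply: number_game_add => //; exact: dyadicB.
Qed.

Lemma gge_add_number G x y : dyadic x -> dyadic y ->
  gle (number_game x) (gadd G (number_game y)) = gle (number_game (x - y)) G.
Proof.
move=> dx dy; rewrite -(gle_add2r (number_game y) _ G); apply: geqv_lel.
rewrite geqv_sym -{2}[x](subrK y); by apply: number_game_add => //; exact: dyadicB.
Qed.

Lemma left_stop_unique G l : is_left_stop G l -> left_stop G = l.
Proof.
move=> [dl cut]; apply: le_anti; apply/andP; split; rewrite leNgt; apply/negP.
  move=> /mid_between[lt1 lt2].
  have dx := dyadic_mid dl (left_stop_dyadic G).
  by have /negP := lt_left_stop dx lt2; apply; have [_] := cut _ dx; apply.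
move=> /mid_between[lt1 lt2].
have dx := dyadic_mid (left_stop_dyadic G) dl.
by have [/(_ lt2)/negP + _] := cut _ dx; apply; exact: gt_left_stop.
Qed.

Lemma right_stop_unique G r : is_right_stop G r -> right_stop G = r.
Proof.
move=> [dr cut]; apply: le_anti; apply/andP; split; rewrite leNgt; apply/negP.
  move=> /mid_between[lt1 lt2].
  have dx := dyadic_mid dr (right_stop_dyadic G).
  by have [_ /(_ lt1)/negP] := cut _ dx; apply; exact: lt_right_stop.
move=> /mid_between[lt1 lt2].
have dx := dyadic_mid (right_stop_dyadic G) dr.
by have /negP := gt_right_stop dx lt1; apply; have [+ _] := cut _ dx; apply.
Qed.

Lemma left_stop_add_number G y : dyadic y ->
  left_stop (gadd G (number_game y)) = left_stop G + y.
Proof.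
move=> dy; apply: left_stop_unique; split; first exact/dyadicD/dy/left_stop_dyadic.
move=> x dx; rewrite gle_add_number // -ltrBlDr -[_ + y < x]ltrBrDr.
by split=> lt_x; [apply: lt_left_stop|apply: gt_left_stop]=> //; exact: dyadicB.
Qed.

Lemma right_stop_add_number G y : dyadic y ->
  right_stop (gadd G (number_game y)) = right_stop G + y.
Proof.
move=> dy; apply: right_stop_unique; split; first exact/dyadicD/dy/right_stop_dyadic.
move=> x dx; rewrite gge_add_number // -ltrBlDr -[_ + y < x]ltrBrDr.
by split=> lt_x; [apply: lt_right_stop|apply: gt_right_stop]=> //; exact: dyadicB.
Qed.

Lemma left_stop_opp G : left_stop (gopp G) = - right_stop G.
Proof.
apply: left_stop_unique; split; first exact/dyadicN/right_stop_dyadic.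
move=> x dx; rewrite -[x]opprK number_game_opp gle_oppC ltrN2 ltrN2.
by split=> lt_x; [apply: gt_right_stop|apply: lt_right_stop]=> //; exact: dyadicN.
Qed.

Lemma right_stop_opp G : right_stop (gopp G) = - left_stop G.
Proof. by rewrite -[G in RHS]goppK left_stop_opp opprK. Qed.

(** * Functions that are affine on a binary grid *)

(** On each cell of the grid of mesh [2 ^- K], [f] is affine with slope [0] or
    [-1] and with values in the grid at the nodes. Both walls of a thermograph
    have this form, up to sign; it is what makes temperatures dyadic. *)
Definition grid_affine (K : nat) (f : rat -> rat) : Prop :=
  forall j : nat, exists (c : int) (b : bool), forall t, dyadic t -> 0 <= t <= 1 ->
    f ((j%:R + t) / 2 ^+ K) = (c%:~R - b%:R * t) / 2 ^+ K.

Lemma grid_affine_ext K f g : (forall p, dyadic p -> 0 <= p -> f p = g p) ->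
  grid_affine K f -> grid_affine K g.
Proof.
move=> fg gf j; have [c [b cb]] := gf j; exists c, b => t dt t01.
rewrite -fg ?cb //.
  have [k [n ->]] := dt.
  exists (j%:Z * 2 ^+ n + k), (n + K)%N; rewrite intrD intrM rmorphXn /= exprD.
  by have := expf2_neq0 n; have := expf2_neq0 K => ? ?; field; apply/andP.
by case/andP: t01 => t0 _; rewrite divr_ge0 ?addr_ge0 ?exprn_ge0.
Qed.

Lemma grid_affine_refine K f : grid_affine K f -> grid_affine K.+1 f.
Proof.
move=> gf j; have [c [b cb]] := gf j./2.
exists (c * 2 - (odd j && b)%:Z), b => t dt /andP[t0 t1].
have jE : j%:R = (odd j)%:R + (j./2)%:R *+ 2 :> rat.
  by rewrite -{1}[j]odd_double_half natrD -mul2n mulr2n natrM mulr_natl mulr2n.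
have := cb (((odd j)%:R + t) / 2); rewrite exprS => fE.
have -> : (j%:R + t) / (2 * 2 ^+ K) = ((j./2)%:R + ((odd j)%:R + t) / 2) / 2 ^+ K.
  by have := expf2_neq0 K => ?; rewrite jE; field.
rewrite fE; first last.
- by case: (odd j); rewrite /= ?(mulr1n, mulr0n); lra.
- by apply: dyadic_half; apply: dyadicD => //; exact: dyadic_nat.
rewrite intrB intrM; have := expf2_neq0 K => ?.
by case: (odd j) => /=; rewrite ?(mulr1n, mulr0n) -?pmulrn; case: b {cb fE} => /=; field.
Qed.

Lemma grid_affine_refine_le K K' f : (K <= K')%N -> grid_affine K f -> grid_affine K' f.
Proof. by move=> /subnK <-; elim: (K' - K)%N => // n IH /IH /grid_affine_refine. Qed.

Lemma grid_affine_flip K f : grid_affine K f -> grid_affine K (fun p => - f p - p).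
Proof.
move=> gf j; have [c [b cb]] := gf j; exists (- c - j%:Z), (~~ b) => t dt t01.
rewrite cb // intrB intrN; have := expf2_neq0 K => ?.
by case: b {cb} => /=; field.
Qed.

Lemma grid_affine_max K f g : grid_affine K f -> grid_affine K g ->
  grid_affine K (fun p => Num.max (f p) (g p)).
Proof.
move=> gf gg j; have [c [b cb]] := gf j; have [c' [b' cb']] := gg j.
have e0 : 0 < (2 ^+ K : rat)^-1 by rewrite invr_gt0 exprn_gt0.
wlog le_c : f g gf gg c b cb c' b' cb' / (c' < c) || (c' == c) && (b <= b')%N.
  move=> WL; have [/WL|] := boolP ((c' < c) || (c' == c) && (b <= b')%N); first exact.
  move=> nle; have [|c'' [b'' E]] := WL g f gg gf c' b' cb' c b cb.
    by move: nle; case: ltgtP => //=; case: b {cb}; case: b' {cb'}.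
  by exists c'', b'' => t dt t01; rewrite maxC E.
exists c, b => t dt /andP[t0 t1]; rewrite cb ?cb' ?t0 ?t1 //.
apply/max_idPl; rewrite ler_pM2r //.
case/orP: le_c => [lt_c|/andP[/eqP -> le_b]].
  have : c'%:~R + 1 <= c%:~R :> rat by rewrite -(intrD _ _ 1) ler_int lezD1.
  by case: b {cb}; case: b' {cb'} => /= ?; lra.
by case: b {cb} le_b; case: b' {cb'} => //= _; lra.
Qed.

Lemma grid_affine_max_seq (T : eqType) K (F : T -> rat -> rat) (s : seq T) :
  s != [::] -> {in s, forall x, grid_affine K (F x)} ->
  exists2 f, grid_affine K f &
    forall p, (exists2 x, x \in s & f p = F x p) /\ {in s, forall x, F x p <= f p}.
Proof.
elim: s => // x s IH _ gF; have [->|s0] := eqVneq s [::].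
  exists (F x) => [|p]; first by apply: gF; exact: mem_head.
  by split=> [|y]; [exists x; rewrite ?mem_head|rewrite inE => /eqP ->].
have [|f gf fE] := IH s0; first by move=> y ys; apply: gF; rewrite inE ys orbT.
exists (fun p => Num.max (F x p) (f p)).
  by apply: grid_affine_max => //; apply: gF; exact: mem_head.
move=> p; have [[y ys yE] leF] := fE p; split.
  case: (leP (F x p) (f p)) => _; last by exists x; rewrite ?mem_head.
  by exists y; rewrite // inE ys orbT.
move=> z; rewrite inE le_max => /orP[/eqP -> | /leF ->]; rewrite ?lexx ?orbT //.
Qed.

Lemma grid_cell K p : dyadic p -> 0 <= p ->
  exists (j : nat) t, [/\ dyadic t, 0 <= t, t < 1 & p = (j%:R + t) / 2 ^+ K].
Proof.
move=> dp p0; have e0 : 0 < (2 ^+ K : rat) by rewrite exprn_gt0.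
have [/andP[le1 lt2]] : ((Num.truncn (p * 2 ^+ K))%:R <= p * 2 ^+ K <
    (Num.truncn (p * 2 ^+ K)).+1%:R) by apply: truncn_itv; rewrite mulr_ge0 // ltW.
set j := Num.truncn _ in le1 lt2.
exists j, (p * 2 ^+ K - j%:R); split.
- have [k [n ->]] := dp; exists (k * 2 ^+ K - j%:Z * 2 ^+ n), n.
  rewrite intrB !intrM !rmorphXn /=; have := expf2_neq0 n => ?; by field.
- by rewrite subr_ge0.
- by rewrite ltrBlDl natr1.
by rewrite addrC subrK mulfK // gt_eqF.
Qed.

(** Slopes in [{0, -1}] make the function nonincreasing and 1-Lipschitz. *)
Lemma grid_affine_mono K f p q : grid_affine K f -> dyadic p -> dyadic q ->
  0 <= p -> p <= q -> f q <= f p <= f q + (q - p).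
Proof.
move=> gf dp dq p0 le_pq; have [j [t [dt t0 /ltW t1 pE]]] := grid_cell K dp p0.
have [i [u [du u0 lt_u uE]]] := grid_cell K dq (le_trans p0 le_pq).
have e0 : 0 < (2 ^+ K : rat)^-1 by rewrite invr_gt0 exprn_gt0.
have cell (j' : nat) x y : dyadic x -> dyadic y -> 0 <= x -> x <= y -> y <= 1 ->
    f ((j'%:R + y) / 2 ^+ K) <= f ((j'%:R + x) / 2 ^+ K) <=
    f ((j'%:R + y) / 2 ^+ K) + ((j'%:R + y) / 2 ^+ K - (j'%:R + x) / 2 ^+ K).
  move=> dx dy x0 xy y1; have [c [b cb]] := gf j'.
  rewrite !cb //; try by rewrite ?x0 ?y1 ?(le_trans x0) ?(le_trans xy).
  rewrite -mulrBl -mulrDl !ler_pM2r //.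
  by case: b {cb} => /=; apply/andP; split; lra.
have le_ji : (j <= i)%N.
  rewrite -ltnS -(ltr_nat rat); move: le_pq; rewrite pE uE ler_pM2r // -natr1; lra.
have d0 : dyadic 0 := dyadic_nat 0; have d1 : dyadic 1 := dyadic_nat 1.
have main d : forall (k : nat) x, (d + k)%N = i -> dyadic x -> 0 <= x -> x <= 1 ->
    k%:R + x <= i%:R + u ->
    f ((i%:R + u) / 2 ^+ K) <= f ((k%:R + x) / 2 ^+ K) <=
    f ((i%:R + u) / 2 ^+ K) + ((i%:R + u) / 2 ^+ K - (k%:R + x) / 2 ^+ K).
  elim: d => [|d IH] k x kE dx x0 x1.
    by rewrite add0n in kE; rewrite kE lerD2l => tu; apply: cell => //; exact: ltW.
  move=> _; have kE' : (d + k.+1)%N = i by rewrite addnS.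
  have /andP[h1 h2] := cell k x 1 dx d1 x0 x1 (lexx 1).
  have : k.+1%:R + 0 <= i%:R + u.
    by rewrite addr0 -kE' natrD; have := ler0n rat d; lra.
  move=> /(IH k.+1 0 kE' d0 (lexx 0) ler01)/andP[].
  rewrite addr0 -[k.+1%:R]natr1 => h3 h4; rewrite (le_trans h3 h1) /=.
  by move: h2 h4; lra.
rewrite uE pE; apply: (main (i - j)%N) => //; first exact: subnK.
by move: le_pq; rewrite pE uE ler_pM2r.
Qed.

(** A sum of two such functions has slopes in [{0, -1, -2}], so its first zero
    sits on the grid of half the mesh. *)
Lemma grid_affine_first_zero K f g : grid_affine K f -> grid_affine K g ->
  0 < f 0 + g 0 -> (exists j : nat, f (j%:R / 2 ^+ K) + g (j%:R / 2 ^+ K) <= 0) ->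
  exists k : nat, let tau : rat := k%:R / 2 ^+ K.+1 in
    [/\ 0 < tau, f tau + g tau = 0 &
        forall q, dyadic q -> 0 <= q -> q < tau -> 0 < f q + g q].
Proof.
move=> gf gg fg0 ex_j; have e0 : 0 < (2 ^+ K : rat)^-1 by rewrite invr_gt0 exprn_gt0.
have [j le_j min_j] := ex_minnP ex_j.
have cell i : exists (c : int) (b : nat), (b <= 2)%N /\ forall t, dyadic t -> 0 <= t <= 1 ->
    f ((i%:R + t) / 2 ^+ K) + g ((i%:R + t) / 2 ^+ K) = (c%:~R - b%:R * t) / 2 ^+ K.
  have [c [b cb]] := gf i; have [c' [b' cb']] := gg i.
  exists (c + c'), (b + b')%N; split; first by case: b {cb}; case: b' {cb'}.
  by move=> t dt t01; rewrite cb // cb' // intrD natrD -mulrDl; congr (_ / _); ring.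
have d0 : dyadic 0 := dyadic_nat 0; have d1 : dyadic 1 := dyadic_nat 1.
have pos_before i : (i < j)%N -> 0 < f (i%:R / 2 ^+ K) + g (i%:R / 2 ^+ K).
  by move=> lt_ij; rewrite ltNge; apply/negP => /min_j; rewrite leqNgt lt_ij.
case: j le_j min_j pos_before => [|j] le_j min_j pos_before.
  by move: le_j; rewrite mul0r leNgt fg0.
have [c [b [b2 cb]]] := cell j.
have c_gt0 : 0 < c.
  have := pos_before j (ltnSn j); rewrite -[j%:R]addr0 cb ?lexx // mulr0 subr0.
  by rewrite pmulr_lgt0 // ltr0z.
have c_leb : c <= b.
  move: le_j; rewrite -[j.+1%:R]natr1 cb ?lexx ?ler01 // mulr1 pmulr_lle0 // subr_le0.
  by rewrite -(ler_int rat).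
have [b' [bE b'P]] : exists b' : nat, b = b'.+1 /\ (b' <= 1)%N.
  by case: (b) b2 c_leb => [|b'] ? ?; [lia|exists b'; split].
have ct : dyadic (c%:~R / b%:R) /\ exists m : nat, c%:~R / b%:R = m%:R / 2 :> rat.
  move: c_leb b'P; rewrite bE; case: b' {bE} => [|[|//]] c_le _.
    by have -> : c = 1; [lia|rewrite divr1; split=> //; exists 2%N; field].
  split; first exact/dyadic_half/dyadic_int.
  by exists `|c|%N; rewrite -[(`|c|%N)%:R]/((`|c|%N)%:Z%:~R) gez0_abs // ltW.
have [dct [m mE]] := ct; have b_gt0 : (0 < b%:R :> rat) by rewrite bE ltr0Sn.
exists (j * 2 + m)%N => tau.
have tauE : tau = (j%:R + c%:~R / b%:R) / 2 ^+ K.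
  by rewrite /tau mE natrD natrM exprS; have := expf2_neq0 K => ?; field.
have ct_gt0 : 0 < c%:~R / b%:R :> rat by rewrite divr_gt0 // ltr0z.
have ct_le1 : c%:~R / b%:R <= 1 :> rat by rewrite ler_pdivrMr // mul1r -(ler_int rat) in c_leb *.
split.
- by rewrite tauE pmulr_lgt0 // ltr_wpDl ?ler0n.
- have ct01 : 0 <= (c%:~R / b%:R : rat) <= 1 by rewrite ct_le1 ltW.
  by rewrite tauE cb // mulrCA divff ?gt_eqF // mulr1 subrr mul0r.
move=> q dq q0; have [i [t [dt t0 t1 qE]]] := grid_cell K dq q0.
rewrite qE tauE ltr_pM2r // => lt_q; have [c' [b'' [_ cb']]] := cell i.
rewrite cb' ?t0 ?ltW // pmulr_lgt0 //.
have le_ij : (i <= j)%N.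
  by rewrite -ltnS -(ltr_nat rat) -natr1; lra.
have : 0 < c'%:~R :> rat.
  have := pos_before i le_ij; rewrite -[i%:R]addr0 cb' ?lexx // mulr0 subr0.
  by rewrite pmulr_lgt0.
have [lt_ij _|le_ji c'0] := ltnP i j.
  have := pos_before i.+1 lt_ij; rewrite -[i.+1%:R]natr1 cb' ?lexx ?ler01 // mulr1 pmulr_lgt0 //.
  by have := ler_wpM2l (ler0n rat b'') (ltW t1); rewrite mulr1; lra.
have ij : i = j by apply/eqP; rewrite eqn_leq le_ij.
rewrite ij ltrD2l in lt_q.
have := cb 0 d0; have := cb' 0 d0; have := cb 1 d1; have := cb' 1 d1.
rewrite ij !lexx ler01 !mulr0 !mulr1 => /(_ isT) -> /(_ isT) E1 /(_ isT) -> /(_ isT) E0.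
have := mulIf (lt0r_neq0 e0) E0; have := mulIf (lt0r_neq0 e0) E1.
move=> E1' E0'; have -> : b''%:R = b%:R :> rat by lra.
have lt_t : t < c%:~R / b%:R by move: lt_q; lra.
by move: lt_t; rewrite ltr_pdivlMr //; lra.
Qed.

Lemma grid_affine_cut K f g (k : nat) :
  grid_affine K f ->
  (forall p, dyadic p -> 0 <= p -> p <= k%:R / 2 ^+ K -> g p = f p) ->
  (forall p, dyadic p -> k%:R / 2 ^+ K <= p -> g p = f (k%:R / 2 ^+ K)) ->
  grid_affine K g.
Proof.
move=> gf low high j; have e0 : 0 < (2 ^+ K : rat)^-1 by rewrite invr_gt0 exprn_gt0.
have dcell t : dyadic t -> dyadic ((j%:R + t) / 2 ^+ K).
  move=> [a [n ->]]; exists (j%:Z * 2 ^+ n + a), (n + K)%N.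
  rewrite intrD intrM rmorphXn /= exprD.
  by have := expf2_neq0 n; have := expf2_neq0 K => ? ?; field; apply/andP.
have [lt_jk|le_kj] := ltnP j k.
  have [c [b cb]] := gf j; exists c, b => t dt /andP[t0 t1].
  rewrite low ?cb ?t0 //; first exact: dcell.
    by rewrite divr_ge0 ?addr_ge0 ?exprn_ge0.
  rewrite ler_pM2r //; have : j.+1%:R <= k%:R :> rat by rewrite ler_nat.
  by rewrite -natr1; lra.
have [c [b cb]] := gf k; exists c, false => t dt /andP[t0 t1].
rewrite high; [|exact: dcell|rewrite ler_pM2r //].
  by rewrite -[k%:R]addr0 cb ?lexx ?ler01 ?mulr0 ?mul0r //; exact: (dyadic_nat 0).
by rewrite -(ler_nat rat) in le_kj; lra.
Qed.

Lemma grid_affine_const K (c : int) f :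
  (forall p, dyadic p -> 0 <= p -> f p = c%:~R / 2 ^+ K) -> grid_affine K f.
Proof.
move=> fE; apply: (@grid_affine_ext _ (fun=> c%:~R / 2 ^+ K)) => [p dp p0|j].
  by rewrite fE.
by exists c, false => t _ _; rewrite mul0r subr0.
Qed.

(** * Thermographs *)

Definition taxed (G : game) (q : rat) : game :=
  Game [seq gadd (penalized g q) (number_game (- q)) | g <- left_options G]
       [seq gadd (penalized g q) (number_game q) | g <- right_options G].

Definition is_tau (G : game) : rat -> Prop :=
  least_nonneg_dyadic (fun q => left_stop (taxed G q) = right_stop (taxed G q)).

Lemma penalizedE G p : penalized G p =
  if pselect (exists tau, is_tau G tau /\ tau < p) is left h
  then number_game (left_stop (taxed G (projT1 (cid h)))) else taxed G p.
Proof. by case: G. Qed.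

Lemma least_nonneg_dyadic_unique P x y :
  least_nonneg_dyadic P x -> least_nonneg_dyadic P y -> x = y.
Proof.
by move=> [dx x0 Px lx] [dy y0 Py ly]; apply: le_anti; rewrite lx // ly.
Qed.

Lemma penalized_below G tau p : is_tau G tau -> p <= tau -> penalized G p = taxed G p.
Proof.
move=> Gt le_pt; rewrite penalizedE; case: pselect => // h; exfalso.
have [t [Gt' lt_tp]] := h.
by move: le_pt; rewrite (least_nonneg_dyadic_unique Gt Gt') leNgt lt_tp.
Qed.

Lemma penalized_above G tau p : is_tau G tau -> tau < p ->
  penalized G p = number_game (left_stop (taxed G tau)).
Proof.
move=> Gt lt_tp; rewrite penalizedE; case: pselect => [h|[]]; last by exists tau.
by have [Gt' _] := projT2 (cid h); rewrite -(least_nonneg_dyadic_unique Gt Gt').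
Qed.

Lemma penalized0 G : geqv (penalized G 0) G.
Proof.
elim/game_options_ind: G => G IHL IHR.
have -> : penalized G 0 = taxed G 0.
  rewrite penalizedE; case: pselect => // h; exfalso.
  by have [t [[_ t0 _ _]]] := h; rewrite ltNge t0.
have num0 : number_game 0 = gzero by rewrite -[0 in LHS]/(0%:~R) number_game_int.
rewrite /geqv; apply/andP; split; apply: gle_options => g /=.
- move=> /mapP[h hin ->]; exists h => //; rewrite oppr0 num0 gadd0.
  by have /andP[] := IHL h hin.
- move=> gin; exists (gadd (penalized g 0) (number_game 0)).
    exact: (map_f (fun g => gadd (penalized g 0) (number_game 0))).
  by rewrite num0 gadd0; have /andP[] := IHR g gin.
- move=> gin; exists (gadd (penalized g 0) (number_game (- 0))).
    exact: (map_f (fun g => gadd (penalized g 0) (number_game (- 0)))).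
  by rewrite oppr0 num0 gadd0; have /andP[] := IHL g gin.
- move=> /mapP[h hin ->]; exists h => //; rewrite num0 gadd0.
  by have /andP[] := IHR h hin.
Qed.

Definition left_wall (G : game) (p : rat) : rat := left_stop (penalized G p).
Definition right_wall (G : game) (p : rat) : rat := right_stop (penalized G p).

Lemma left_wall_dyadic G p : dyadic (left_wall G p).
Proof. exact: left_stop_dyadic. Qed.

Lemma right_wall_dyadic G p : dyadic (right_wall G p).
Proof. exact: right_stop_dyadic. Qed.

Lemma left_wall0 G : left_wall G 0 = left_stop G.
Proof. exact/left_stop_eqv/penalized0. Qed.

Lemma right_wall0 G : right_wall G 0 = right_stop G.
Proof. exact/right_stop_eqv/penalized0. Qed.

Lemma right_wall_le_left G p : right_wall G p <= left_wall G p.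
Proof. exact: right_stop_left_stop. Qed.

Lemma taxed_left G p g : g \in left_options G ->
  gadd (penalized g p) (number_game (- p)) \in left_options (taxed G p).
Proof. exact: (map_f (fun g => gadd (penalized g p) (number_game (- p)))). Qed.

Lemma taxed_right G p g : g \in right_options G ->
  gadd (penalized g p) (number_game p) \in right_options (taxed G p).
Proof. exact: (map_f (fun g => gadd (penalized g p) (number_game p))). Qed.

Lemma taxed_left_stop_ge G p g : dyadic p -> g \in left_options G ->
  right_wall g p - p <= left_stop (taxed G p).
Proof.
move=> dp /(taxed_left p)/left_option_stop.
by rewrite right_stop_add_number //; exact: dyadicN.
Qed.

Lemma taxed_right_stop_le G p g : dyadic p -> g \in right_options G ->
  right_stop (taxed G p) <= left_wall g p + p.
Proof. by move=> dp /(taxed_right p)/right_option_stop; rewrite left_stop_add_number. Qed.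

Lemma taxed_stops_attained G p : dyadic p ->
  right_stop (taxed G p) < left_stop (taxed G p) ->
  (exists2 g, g \in left_options G & left_stop (taxed G p) = right_wall g p - p) /\
  (exists2 g, g \in right_options G & right_stop (taxed G p) = left_wall g p + p).
Proof.
move=> dp /stop_gap_not_number nG; split.
  have [x /mapP[g gin ->] ->] := left_stop_attained nG; exists g => //.
  by rewrite right_stop_add_number //; exact: dyadicN.
have [x /mapP[g gin ->] ->] := right_stop_attained nG; exists g => //.
by rewrite left_stop_add_number.
Qed.

Definition has_thermograph (G : game) (tau : rat) : Prop :=
  [/\ is_tau G tau,
      exists K, grid_affine K (left_wall G) /\ grid_affine K (fun p => - right_wall G p)
    & 0 < tau -> forall p, dyadic p -> 0 <= p -> p <= tau ->
        (exists2 g, g \in left_options G & left_wall G p = right_wall g p - p) /\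
        (exists2 g, g \in right_options G & right_wall G p = left_wall g p + p)].

Lemma common_grid (s : seq game) :
  {in s, forall g, exists K, grid_affine K (left_wall g) /\
                             grid_affine K (fun p => - right_wall g p)} ->
  exists K, {in s, forall g, grid_affine K (left_wall g) /\
                             grid_affine K (fun p => - right_wall g p)}.
Proof.
elim: s => [|g s IH] gs; first by exists 0%N.
have [|K KP] := IH; first by move=> h hs; apply: gs; rewrite inE hs orbT.
have [K' [gl gr]] := gs g (mem_head _ _); exists (maxn K K') => h.
rewrite inE => /orP[/eqP ->|/KP[hl hr]]; split.
- exact: grid_affine_refine_le (leq_maxr _ _) gl.
- exact: grid_affine_refine_le (leq_maxr _ _) gr.
- exact: grid_affine_refine_le (leq_maxl _ _) hl.
- exact: grid_affine_refine_le (leq_maxl _ _) hr.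
Qed.

(** Below the temperature the walls are the scaffolds, that is the extreme
    taxed walls of the options, and above it a vertical mast. The grid shape of
    the option walls makes the scaffolds meet at a dyadic point, and the walls
    inherit the shape on the grid of half the mesh. *)
Lemma thermograph_exists G : exists tau, has_thermograph G tau.
Proof.
elim/game_options_ind: G => G IHL IHR.
have d0 : dyadic 0 := dyadic_nat 0.
have [stops0|gap0] := eqVneq (left_stop (taxed G 0)) (right_stop (taxed G 0)).
  exists 0; have tau0 : is_tau G 0 by split.
  have dx := left_stop_dyadic (taxed G 0).
  have pen p : dyadic p -> 0 <= p ->
      left_wall G p = left_stop (taxed G 0) /\ right_wall G p = left_stop (taxed G 0).
    rewrite /left_wall /right_wall le_eqVlt => dp /orP[/eqP <-|p0].
      by rewrite (penalized_below tau0) ?lexx.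
    by rewrite (penalized_above tau0) // left_stop_number ?right_stop_number.
  split=> //; have [k [n xE]] := dx; exists n; split.
    by apply: (@grid_affine_const _ k) => p dp p0; have [-> _] := pen p dp p0.
  apply: (@grid_affine_const _ (- k)) => p dp p0; have [_ ->] := pen p dp p0.
  by rewrite xE intrN mulNr.
have lt0 : right_stop (taxed G 0) < left_stop (taxed G 0).
  by rewrite lt_neqAle eq_sym gap0 right_stop_left_stop.
have [L0 R0] : left_options G != [::] /\ right_options G != [::].
  have [[g gin _] [h hin _]] := taxed_stops_attained d0 lt0.
  by split; apply/eqP => E; rewrite E in gin hin.
have [K KP] : exists K, {in left_options G ++ right_options G, forall g,
    grid_affine K (left_wall g) /\ grid_affine K (fun p => - right_wall g p)}.
  apply: common_grid => g; rewrite mem_cat => /orP[/IHL|/IHR] [t [_ + _]] //.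
have [|l gl lP] := @grid_affine_max_seq _ K (fun g p => - - right_wall g p - p) _ L0.
  by move=> g gin; apply: grid_affine_flip; apply: (KP g _).2; rewrite mem_cat gin.
have [|r gr rP] := @grid_affine_max_seq _ K (fun g p => - left_wall g p - p) _ R0.
  by move=> g gin; apply: grid_affine_flip; apply: (KP g _).1; rewrite mem_cat gin orbT.
have le_l p : dyadic p -> l p <= left_stop (taxed G p).
  by move=> dp; have [[g gin ->] _] := lP p; rewrite opprK taxed_left_stop_ge.
have le_r p : dyadic p -> right_stop (taxed G p) <= - r p.
  move=> dp; have [[g gin ->] _] := rP p; rewrite opprD !opprK.
  exact: taxed_right_stop_le.
have hot_stops p : dyadic p -> right_stop (taxed G p) < left_stop (taxed G p) ->
    left_stop (taxed G p) = l p /\ right_stop (taxed G p) = - r p.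
  move=> dp /(taxed_stops_attained dp)[[g gin lE] [h hin rE]].
  have := (lP p).2 g gin; have := (rP p).2 h hin; rewrite opprK => le_h le_g.
  by split; apply: le_anti; rewrite ?le_l ?le_r // ?lE ?rE; lra.
have stops_pos p : dyadic p -> 0 < l p + r p ->
    right_stop (taxed G p) < left_stop (taxed G p).
  by move=> dp pos; have := le_l p dp; have := le_r p dp; lra.
have stops_eq p : dyadic p -> l p + r p <= 0 ->
    left_stop (taxed G p) = right_stop (taxed G p).
  move=> dp npos; apply: le_anti; rewrite right_stop_left_stop andbT leNgt.
  by apply/negP => lt_p; have [] := hot_stops p dp lt_p; move: lt_p; lra.
have pos0 : 0 < l 0 + r 0.
  by have [] := hot_stops 0 d0 lt0; move: lt0; lra.
have [j le_j] : exists j : nat, l (j%:R / 2 ^+ K) + r (j%:R / 2 ^+ K) <= 0.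
  have [|x dx lt_x] := @dyadic_above [seq left_wall g 0 | g <- left_options G].
    by move=> _ /mapP[g _ ->]; exact: left_wall_dyadic.
  have [|y dy lt_y] := @dyadic_below [seq right_wall g 0 | g <- right_options G].
    by move=> _ /mapP[g _ ->]; exact: right_wall_dyadic.
  (* The walls of the options at tax [0] bound the scaffolds by [x - p] from
     above and by [y + p] from below, so they have crossed at [p >= |x - y|]. *)
  pose m := Num.bound `|x - y|; exists (m * 2 ^ K)%N.
  have -> : (m * 2 ^ K)%:R / 2 ^+ K = m%:R :> rat.
    by rewrite natrM natrX mulfK // expf2_neq0.
  have dm : dyadic m%:R := dyadic_nat m; have m0 : 0 <= m%:R :> rat := ler0n _ _.
  have [[g gin ->] _] := lP m%:R; have [[h hin ->] _] := rP m%:R; rewrite opprK.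
  have [gg' _] := KP g (ltac:(by rewrite mem_cat gin)).
  have [_ gh'] := KP h (ltac:(by rewrite mem_cat hin orbT)).
  have /andP[le1 _] := grid_affine_mono gg' d0 dm (lexx 0) m0.
  have /andP[le2 _] := grid_affine_mono gh' d0 dm (lexx 0) m0.
  have := lt_x _ (map_f (left_wall^~ 0) gin); have := lt_y _ (map_f (right_wall^~ 0) hin).
  have := right_wall_le_left g m%:R; have := right_wall_le_left h m%:R.
  have := archi_boundP (normr_ge0 (x - y)); rewrite -/m; have := ler_norm (x - y).
  move: le1 le2; lra.
have [k [tau_gt0 tau0 pos_below]] := grid_affine_first_zero gl gr pos0 (ex_intro _ j le_j).
set tau : rat := k%:R / 2 ^+ K.+1 in tau_gt0 tau0 pos_below.
have dtau : dyadic tau by exists k%:Z, K.+1.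
have tauP : is_tau G tau.
  split=> //; [exact: ltW|by apply: stops_eq; rewrite // tau0|].
  move=> q dq q0 eq_q; rewrite leNgt; apply/negP => /(pos_below q dq q0)/(stops_pos q dq).
  by rewrite eq_q ltxx.
have walls_tau : left_stop (taxed G tau) = l tau /\ right_stop (taxed G tau) = - r tau.
  have := stops_eq tau dtau; rewrite tau0 lexx => /(_ isT).
  have := le_l tau dtau; have := le_r tau dtau; move: tau0.
  by move=> ? ? ? ?; split; lra.
have walls_below p : dyadic p -> 0 <= p -> p <= tau ->
    left_wall G p = l p /\ right_wall G p = - r p.
  move=> dp p0; rewrite /left_wall /right_wall le_eqVlt => /orP[/eqP ->|lt_p].
    by rewrite (penalized_below tauP).
  rewrite (penalized_below tauP) ?ltW //; apply: hot_stops => //.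
  exact/stops_pos/pos_below.
have walls_above p : dyadic p -> tau <= p ->
    left_wall G p = l tau /\ right_wall G p = - r tau.
  move=> dp; rewrite le_eqVlt => /orP[/eqP <-|lt_p].
    exact: (walls_below tau dtau (ltW tau_gt0) (lexx _)).
  rewrite /left_wall /right_wall (penalized_above tauP lt_p) walls_tau.1.
  have dl : dyadic (l tau) by rewrite -walls_tau.1; exact: left_stop_dyadic.
  by rewrite left_stop_number ?right_stop_number //; split=> //; lra.
exists tau; split=> //.
  exists K.+1; split.
    apply: (grid_affine_cut (k := k) (grid_affine_refine gl)) => p dp.
      by move=> p0 pt; have [] := walls_below p dp p0 pt.
    by move=> tp; have [] := walls_above p dp tp.
  apply: (grid_affine_cut (k := k) (grid_affine_refine gr)) => p dp.
    by move=> p0 pt; have [_ ->] := walls_below p dp p0 pt; rewrite opprK.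
  by move=> tp; have [_ ->] := walls_above p dp tp; rewrite opprK.
move=> _ p dp p0 pt; have [-> ->] := walls_below p dp p0 pt; split.
  by have [[g gin ->] _] := lP p; exists g; rewrite // opprK.
by have [[g gin ->] _] := rP p; exists g; rewrite // opprD !opprK.
Qed.

Definition tau (G : game) : rat := projT1 (cid (thermograph_exists G)).

Lemma tauP G : has_thermograph G (tau G).
Proof. exact: projT2 (cid (thermograph_exists G)). Qed.

Lemma tau_dyadic G : dyadic (tau G).
Proof. by have [[]] := tauP G. Qed.

Lemma tau_ge0 G : 0 <= tau G.
Proof. by have [[]] := tauP G. Qed.

Lemma left_wall_slope G p q : dyadic p -> dyadic q -> 0 <= p -> p <= q ->
  left_wall G q <= left_wall G p <= left_wall G q + (q - p).
Proof.
move=> dp dq p0 pq; have [_ [K [gl _]] _] := tauP G.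
exact: grid_affine_mono gl _ _ _ _.
Qed.

Lemma right_wall_slope G p q : dyadic p -> dyadic q -> 0 <= p -> p <= q ->
  right_wall G p <= right_wall G q <= right_wall G p + (q - p).
Proof.
move=> dp dq p0 pq; have [_ [K [_ gr]] _] := tauP G.
by have /andP[] := grid_affine_mono gr dp dq p0 pq; rewrite lerN2 => -> /=; lra.
Qed.

Lemma left_wall_anti G p q : dyadic p -> dyadic q -> 0 <= p -> p <= q ->
  left_wall G q <= left_wall G p.
Proof. by move=> dp dq p0 pq; have /andP[] := left_wall_slope G dp dq p0 pq. Qed.

Lemma right_wall_homo G p q : dyadic p -> dyadic q -> 0 <= p -> p <= q ->
  right_wall G p <= right_wall G q.
Proof. by move=> dp dq p0 pq; have /andP[] := right_wall_slope G dp dq p0 pq. Qed.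

Lemma walls_tau G : left_wall G (tau G) = right_wall G (tau G).
Proof.
have [tP _ _] := tauP G; rewrite /left_wall /right_wall (penalized_below tP) //.
by case: tP.
Qed.

Lemma walls_gap G p : dyadic p -> 0 <= p -> p < tau G -> right_wall G p < left_wall G p.
Proof.
move=> dp p0 lt_p; rewrite lt_neqAle right_wall_le_left andbT; apply/eqP => E.
have [tP _ _] := tauP G; have [_ _ _ /(_ p dp p0) tmin] := tP.
have /tmin : left_stop (taxed G p) = right_stop (taxed G p).
  by move: E; rewrite /left_wall /right_wall (penalized_below tP) ?ltW.
by rewrite leNgt lt_p.
Qed.

Lemma mast G p : tau G <= p ->
  left_wall G p = left_wall G (tau G) /\ right_wall G p = left_wall G (tau G).
Proof.
have [tP _ _] := tauP G.
rewrite le_eqVlt => /orP[/eqP <-|lt_p]; first by rewrite -walls_tau.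
have dx := left_stop_dyadic (taxed G (tau G)).
rewrite /left_wall /right_wall (penalized_above tP lt_p) (penalized_below tP) //.
by rewrite left_stop_number ?right_stop_number.
Qed.

Lemma wall_gap_lt_tau G p : right_wall G p < left_wall G p -> p < tau G.
Proof.
by move=> gap; rewrite ltNge; apply/negP => /mast[lE rE]; rewrite lE rE ltxx in gap.
Qed.

Lemma walls_attained G p : dyadic p -> 0 <= p -> p <= tau G -> 0 < tau G ->
  (exists2 g, g \in left_options G & left_wall G p = right_wall g p - p) /\
  (exists2 g, g \in right_options G & right_wall G p = left_wall g p + p).
Proof. by move=> dp p0 pt t0; have [_ _ att] := tauP G; exact: att. Qed.

Lemma wall_gap_attained G p : dyadic p -> 0 <= p -> right_wall G p < left_wall G p ->
  (exists2 g, g \in left_options G & left_wall G p = right_wall g p - p) /\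
  (exists2 g, g \in right_options G & right_wall G p = left_wall g p + p).
Proof.
move=> dp p0 /wall_gap_lt_tau lt_p; apply: walls_attained => //; first exact: ltW.
exact: le_lt_trans lt_p.
Qed.

Lemma left_wall_ge_option G g p : dyadic p -> 0 <= p -> g \in left_options G ->
  right_wall g p - p <= left_wall G p.
Proof.
move=> dp p0 gin; have [tP _ _] := tauP G; have dt := tau_dyadic G.
have low q : dyadic q -> q <= tau G -> right_wall g q - q <= left_wall G q.
  by move=> dq qt; rewrite /left_wall (penalized_below tP qt) taxed_left_stop_ge.
have [pt|/ltW tp] := leP p (tau G); first exact: low.
have [-> _] := mast tp; apply: le_trans (low _ dt (lexx _)).
by have /andP[_] := right_wall_slope g dt dp (tau_ge0 G) tp; lra.
Qed.

Lemma right_wall_le_option G g p : dyadic p -> 0 <= p -> g \in right_options G ->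
  right_wall G p <= left_wall g p + p.
Proof.
move=> dp p0 gin; have [tP _ _] := tauP G; have dt := tau_dyadic G.
have low q : dyadic q -> q <= tau G -> right_wall G q <= left_wall g q + q.
  by move=> dq qt; rewrite /right_wall (penalized_below tP qt) taxed_right_stop_le.
have [pt|/ltW tp] := leP p (tau G); first exact: low.
have [_ ->] := mast tp; rewrite walls_tau; apply: le_trans (low _ dt (lexx _)) _.
by have /andP[_] := left_wall_slope g dt dp (tau_ge0 G) tp; lra.
Qed.

Lemma tau_least G :
  least_nonneg_dyadic (fun p => left_wall G p = right_wall G p) (tau G).
Proof.
split; [exact: tau_dyadic|exact: tau_ge0|exact: walls_tau|].
by move=> q dq q0 E; rewrite leNgt; apply/negP => /(walls_gap dq q0); rewrite E ltxx.
Qed.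

(** Form does not matter: already at tax [0] the stops of a number agree, so its
    thermograph is a mast from the start. *)
Lemma walls_number G x p : equals_dyadic G x -> 0 <= p ->
  left_wall G p = x /\ right_wall G p = x.
Proof.
move=> Gx p0.
have [l0 r0] : left_wall G 0 = x /\ right_wall G 0 = x.
  by rewrite left_wall0 right_wall0 /left_stop /right_stop !(stop_number _ Gx).
have t0 : tau G = 0.
  apply: le_anti; rewrite tau_ge0 andbT; have [_ _ _] := tau_least G; apply=> //.
    exact: (dyadic_nat 0).
  by rewrite l0.
have tp : tau G <= p by rewrite t0.
by have [-> ->] := mast tp; rewrite t0.
Qed.

Lemma penalized_opp G p : penalized (gopp G) p = gopp (penalized G p).
Proof.
elim/game_options_ind: G p => G IHL IHR p.
have taxed_opp q : taxed (gopp G) q = gopp (taxed G q).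
  rewrite /taxed /= left_options_opp right_options_opp -!map_comp.
  congr Game; apply/eq_in_map => g gin /=.
    by rewrite IHR // goppD number_game_opp.
  by rewrite IHL // goppD -number_game_opp opprK.
have tau_opp t : is_tau (gopp G) t <-> is_tau G t.
  have E q : left_stop (taxed (gopp G) q) = right_stop (taxed (gopp G) q) <->
             left_stop (taxed G q) = right_stop (taxed G q).
    rewrite taxed_opp left_stop_opp right_stop_opp.
    by split=> [/oppr_inj ->|->].
  split=> -[dt t0 Pt lt]; split=> //; try exact/E; by move=> q dq q0 /E; exact: lt.
have [tP _ _] := tauP G; have tP' : is_tau (gopp G) (tau G) by apply/tau_opp.
have [pt|tp] := leP p (tau G).
  by rewrite (penalized_below tP pt) (penalized_below tP' pt).
rewrite (penalized_above tP tp) (penalized_above tP' tp) taxed_opp left_stop_opp.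
by rewrite number_game_opp; have [_ _ -> _] := tP.
Qed.

Lemma left_wall_opp G p : left_wall (gopp G) p = - right_wall G p.
Proof. by rewrite /left_wall penalized_opp left_stop_opp. Qed.

Lemma right_wall_opp G p : right_wall (gopp G) p = - left_wall G p.
Proof. by rewrite /right_wall penalized_opp right_stop_opp. Qed.

(** Walls respect the order of games, so that they may be computed on any form
    of a game instead of its canonical form. Up to the temperature of [G] its
    Left wall is attained at some [G^L], and [G^L] is below some [H^L] or has a
    Right option below [H]; either way the induction applies. Past the
    temperature of one of the games the comparison is carried by monotonicity
    from the tax at which its mast starts. *)
Lemma walls_le G H p : gle G H -> dyadic p -> 0 <= p ->
  left_wall G p <= left_wall H p /\ right_wall G p <= right_wall H p.
Proof.
have [m] := ubnP (gsize G + gsize H)%N; elim: m G H p => // m IH G H p lt_m GH dp p0.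
have lowL q : dyadic q -> 0 <= q -> q <= tau G -> left_wall G q <= left_wall H q.
  move=> dq; rewrite le_eqVlt => /orP[/eqP <- _|q0 qt].
    by rewrite !left_wall0 left_stop_le.
  have [[g gin ->] _] := walls_attained dq (ltW q0) qt (lt_le_trans q0 qt).
  have lt_g := gsize_left gin; have /lf_options[[h hin le_gh]|[h hin le_hH]] : ~~ gle H g.
  - by apply: contraNN (left_lf gin); exact: gle_trans.
  - apply: le_trans _ (left_wall_ge_option dq (ltW q0) hin); rewrite lerD2r.
    by have lt_h := gsize_left hin; apply: (IH g h _ _ _ _ _).2 => //; [lia|exact: ltW].
  have lt_h := gsize_right hin; rewrite lerBlDr.
  apply: le_trans (right_wall_le_option dq (ltW q0) hin) _; rewrite lerD2r.
  by apply: (IH h H _ _ _ _ _).1 => //; [lia|exact: ltW].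
have lowR q : dyadic q -> 0 <= q -> q <= tau H -> right_wall G q <= right_wall H q.
  move=> dq; rewrite le_eqVlt => /orP[/eqP <- _|q0 qt].
    by rewrite !right_wall0 right_stop_le.
  have [_ [h hin ->]] := walls_attained dq (ltW q0) qt (lt_le_trans q0 qt).
  have lt_h := gsize_right hin; have /lf_options[[g gin le_g]|[g gin le_g]] : ~~ gle h G.
  - by apply: contraNN (right_lf hin) => /gle_trans; apply.
  - have lt_g := gsize_left gin; rewrite -lerBlDr.
    apply: le_trans _ (left_wall_ge_option dq (ltW q0) gin); rewrite lerD2r.
    by apply: (IH G g _ _ _ _ _).2 => //; [lia|exact: ltW].
  apply: le_trans (right_wall_le_option dq (ltW q0) gin) _; rewrite lerD2r.
  by have lt_g := gsize_right gin; apply: (IH g h _ _ _ _ _).1 => //; [lia|exact: ltW].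
have dG := tau_dyadic G; have dH := tau_dyadic H; have tG := tau_ge0 G; have tH := tau_ge0 H.
split.
  have [|lt_Gp] := leP p (tau G); first exact: lowL.
  have [lE rE] := mast (ltW lt_Gp); rewrite lE.
  have [le_GH|lt_HG] := leP (tau G) (tau H).
    rewrite walls_tau; apply: le_trans (lowR _ dG tG le_GH) _.
    by apply: le_trans (right_wall_le_left _ _); apply: right_wall_homo => //; exact: ltW.
  have [-> _] := mast (ltW (lt_trans lt_HG lt_Gp)).
  by apply: le_trans (lowL _ dH tH (ltW lt_HG)); apply: left_wall_anti => //; exact: ltW.
have [|lt_Hp] := leP p (tau H); first exact: lowR.
have [lE rE] := mast (ltW lt_Hp); rewrite rE.
have [le_HG|lt_GH] := leP (tau H) (tau G).
  apply: le_trans (lowL _ dH tH le_HG).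
  by apply: le_trans (right_wall_le_left _ _) _; apply: left_wall_anti => //; exact: ltW.
have [_ ->] := mast (ltW (lt_trans lt_GH lt_Hp)); rewrite !walls_tau.
by apply: le_trans (lowR _ dG tG (ltW lt_GH)) _; apply: right_wall_homo => //; exact: ltW.
Qed.

Lemma left_wall_eqv G H p : geqv G H -> dyadic p -> 0 <= p -> left_wall G p = left_wall H p.
Proof.
move=> /andP[GH HG] dp p0; apply: le_anti.
by rewrite (walls_le GH dp p0).1 (walls_le HG dp p0).1.
Qed.

Lemma right_wall_eqv G H p : geqv G H -> dyadic p -> 0 <= p -> right_wall G p = right_wall H p.
Proof.
move=> /andP[GH HG] dp p0; apply: le_anti.
by rewrite (walls_le GH dp p0).2 (walls_le HG dp p0).2.
Qed.

(** * The mean value *)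

Definition gsum (s : seq game) : game := foldr gadd gzero s.

Lemma gsum_cons g s : gsum (g :: s) = gadd g (gsum s).
Proof. by []. Qed.

Lemma gsum_cat s t : gsum (s ++ t) = gadd (gsum s) (gsum t).
Proof.
elim: s => [|g s IH]; first by rewrite add0g.
by rewrite cat_cons !gsum_cons IH gaddA.
Qed.

Lemma gsum_left s1 g s2 h : h \in left_options g ->
  gsum (s1 ++ h :: s2) \in left_options (gsum (s1 ++ g :: s2)).
Proof. by move=> hin; rewrite !gsum_cat; apply: left_addr; exact: left_addl. Qed.

Lemma gsum_right_inv s x : x \in right_options (gsum s) ->
  exists s1 g s2 h, [/\ s = s1 ++ g :: s2, h \in right_options g & x = gsum (s1 ++ h :: s2)].
Proof.
elim: s x => [x|g s IH]; first by rewrite in_nil.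
apply: right_add_inv => [h hin|y /IH].
  by exists [::], g, s, h.
by move=> [s1 [k [s2 [h [-> hin ->]]]]]; exists (g :: s1), k, s2, h.
Qed.

Lemma gsum_number s : {in s, forall g, is_number g} ->
  equals_dyadic (gsum s) (\sum_(g <- s) right_wall g 0).
Proof.
elim: s => [_|g s IH ns].
  rewrite big_nil; split; first exact: (dyadic_nat 0).
  by rewrite -[0]/(0%:~R) number_game_int geqv_refl.
have [|ds sE] := IH; first by move=> h hs; apply: ns; rewrite inE hs orbT.
have [x [dx gE]] := ns g (mem_head _ _).
have [_ xE] := walls_number (conj dx gE : equals_dyadic g x) (lexx 0).
rewrite big_cons xE; split; first exact: dyadicD.
by apply: geqv_trans (geqv_add gE sE) _; exact: number_game_add.
Qed.

Lemma left_wins_first G : left_wins true G = ~~ gle G gzero.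
Proof. by rewrite -left_wins_subT gadd0. Qed.

Definition wall_sum (p : rat) (s : seq game) : rat := \sum_(g <- s) right_wall g p.

Lemma wall_sum_cat p s1 g s2 :
  wall_sum p (s1 ++ g :: s2) = wall_sum p s1 + right_wall g p + wall_sum p s2.
Proof. by rewrite /wall_sum big_cat big_cons /= addrA. Qed.

Definition total_size (s : seq game) : nat := sumn [seq gsize g | g <- s].

Lemma total_size_cat s1 g s2 :
  total_size (s1 ++ g :: s2) = (total_size s1 + gsize g + total_size s2)%N.
Proof. by rewrite /total_size map_cat sumn_cat /= addnA. Qed.

(** Left's move in the thermostrat strategy: play in a component whose walls
    are apart at [p]; if all are frozen, lower [p] until the hottest component
    is just about to thaw. In both cases the sum of the Right walls after the
    move exceeds the ambient temperature. The exception is a sum of numbers,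
    whose value is positive and which Left wins outright. *)
Lemma thermostrat_move s p k1 k k2 : dyadic p -> 0 <= p ->
  s = k1 ++ k :: k2 -> 0 < wall_sum p k1 + left_wall k p + wall_sum p k2 ->
  left_wins true (gsum s) \/
  exists s1 g s2 h q, [/\ s = s1 ++ g :: s2, h \in left_options g, dyadic q, 0 <= q
                       & q < wall_sum q (s1 ++ h :: s2)].
Proof.
move=> dp p0 sE pos.
have at_gap s1 g s2 : s = s1 ++ g :: s2 -> right_wall g p < left_wall g p ->
    0 < wall_sum p s1 + left_wall g p + wall_sum p s2 ->
    exists s1 g s2 h q, [/\ s = s1 ++ g :: s2, h \in left_options g, dyadic q, 0 <= q
                         & q < wall_sum q (s1 ++ h :: s2)].
  move=> sE' /(wall_gap_attained dp p0)[[h hin lE] _] pos'.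
  by exists s1, g, s2, h, p; split=> //; rewrite wall_sum_cat; move: pos'; lra.
have [gap|] := boolP (right_wall k p < left_wall k p); first by right; exact: at_gap gap pos.
rewrite -leNgt => no_gap; have pos_s : 0 < wall_sum p s.
  by rewrite sE wall_sum_cat; move: pos; lra.
have split_at g : g \in s -> exists s1 s2, s = s1 ++ g :: s2.
  by case/splitPr => s1 s2; exists s1, s2.
have [[g gin gap]|cold] := pselect (exists2 g, g \in s & right_wall g p < left_wall g p).
  right; have [s1 [s2 sE']] := split_at g gin; apply: (at_gap s1 g s2 sE' gap).
  by move: pos_s gap; rewrite sE' wall_sum_cat; lra.
have tau_le g : g \in s -> tau g <= p.
  by move=> gin; rewrite leNgt; apply/negP => /(walls_gap dp p0) gap; apply: cold; exists g.
have [|/mapP[g gin tE] tau_max] := @seq_max_spec [seq tau g | g <- s].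
  by rewrite sE; case: (k1).
have {}tau_max h : h \in s -> tau h <= tau g.
  by move=> hin; rewrite -tE; apply: tau_max; exact: map_f.
have [s1 [s2 sE']] := split_at g gin; have dt := tau_dyadic g; have t0 := tau_ge0 g.
have sum_tau : wall_sum (tau g) s = wall_sum p s.
  apply: eq_big_seq => h hin.
  by have [_ ->] := mast (tau_max h hin); have [_ ->] := mast (tau_le h hin).
have := t0; rewrite le_eqVlt => /orP[/eqP t0E|t_gt0].
  have [numbers|[h hin hot_h]] : {in s, forall h, is_number h} \/
      exists2 h, h \in s & ~ is_number h.
    have [|/existsNP[h /not_implyP[hin hot_h]]] := pselect {in s, forall h, is_number h}.
      by left.
    by right; exists h.
    have [dx /andP[_ le_x]] := gsum_number numbers; left.
    rewrite left_wins_first; apply: lf_gle_trans _ le_x.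
    have -> : gzero = number_game 0 by rewrite -[0]/(0%:~R) number_game_int.
    rewrite number_game_le //; last exact: (dyadic_nat 0).
    by rewrite -ltNge; move: pos_s; rewrite -sum_tau -t0E.
  have [h' h'in lE] := left_stop_attained hot_h; right.
  have [u1 [u2 uE]] := split_at h hin; exists u1, h, u2, h', 0; split=> //.
    exact: (dyadic_nat 0).
  have [_ rE] := mast (tau_max h hin); have th0 : tau h = 0.
    by apply: le_anti; rewrite tau_ge0 andbT t0E tau_max.
  move: pos_s; rewrite -sum_tau -t0E uE !wall_sum_cat.
  by rewrite -t0E th0 in rE; rewrite rE left_wall0 lE right_wall0.
have [[h hin lE] _] := walls_attained dt t0 (lexx _) t_gt0.
right; exists s1, g, s2, h, (tau g); split=> //.
move: pos_s; rewrite -sum_tau sE' !wall_sum_cat -walls_tau lE; lra.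
Qed.

(** The thermostrat guarantee. If Right moves a component [g] to [h], then the
    Right wall of [g] is at most the Left wall of [h] plus [p]; so the sum stays
    positive when [h] counts by its Left wall, and Left has the answer of the
    previous lemma. *)
Lemma thermostrat s p : dyadic p -> 0 <= p -> p < wall_sum p s ->
  left_wins false (gsum s).
Proof.
have [m] := ubnP (total_size s); elim: m s p => // m IH s p lt_m dp p0 lt_p.
rewrite left_winsF; apply/allP => x /gsum_right_inv[s1 [g [s2 [h [sE hin ->]]]]].
have lt_h := gsize_right hin.
have [|//|[u1 [k [u2 [k' [q [uE k'in dq q0 lt_q]]]]]]] :=
    @thermostrat_move (s1 ++ h :: s2) p s1 h s2 dp p0 erefl.
  have := right_wall_le_option dp p0 hin.
  by move: lt_p; rewrite sE wall_sum_cat; lra.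
rewrite left_winsT uE; apply/hasP; exists (gsum (u1 ++ k' :: u2)); first exact: gsum_left.
have lt_k := gsize_left k'in; apply: (IH _ q) => //.
have := congr1 total_size uE; move: lt_m; rewrite sE !total_size_cat.
by lia.
Qed.

Lemma gmuln_gsum N G : gmuln N G = gsum (nseq N G).
Proof. by elim: N => //= N ->. Qed.

Lemma gmuln_opp N G : gopp (gmuln N G) = gmuln N (gopp G).
Proof. by elim: N => //= N IH; rewrite goppD IH. Qed.

Lemma wall_sum_nseq p N G : wall_sum p (nseq N G) = N%:R * right_wall G p.
Proof. by rewrite /wall_sum big_nseq iter_addr_0 mulr_natl. Qed.

Lemma gmuln_le G H p N : dyadic p -> 0 <= p ->
  p < N%:R * (right_wall H p - left_wall G p) -> gle (gmuln N G) (gmuln N H).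
Proof.
move=> dp p0 lt_p; rewrite /gle gmuln_opp !gmuln_gsum -gsum_cat.
apply: (thermostrat dp p0); rewrite /wall_sum big_cat /= -!/(wall_sum _ _) !wall_sum_nseq.
by rewrite right_wall_opp -mulrDr.
Qed.

(** At the temperature, the Right walls of [N] copies of [G] and of
    [- (m - eps)] add up to [N * eps], which outgrows the fixed temperature. *)
Lemma mean_value_mast G : is_mean_value G (left_wall G (tau G)).
Proof.
have dm := left_wall_dyadic G (tau G); split=> // eps deps eps0.
have dt := tau_dyadic G; have t0 := tau_ge0 G.
exists (Num.bound (tau G / eps)) => N le_N.
have lt_N : tau G < N%:R * eps.
  rewrite -ltr_pdivrMr //; apply: lt_le_trans (archi_boundP _) _; first by rewrite divr_ge0 // ltW.
  by rewrite ler_nat.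
have num x : dyadic x -> left_wall (number_game x) (tau G) = x /\
    right_wall (number_game x) (tau G) = x.
  by move=> dx; exact: walls_number (equals_dyadic_number dx) t0.
apply/andP; split; apply: (gmuln_le dt t0).
  have [-> _] := num _ (dyadicB dm deps); rewrite -walls_tau.
  by rewrite opprB addrC subrK.
have [_ ->] := num _ (dyadicD dm deps).
by rewrite addrAC subrr add0r.
Qed.

(** * Canonical forms and temperature *)

Lemma gsizeE G :
  gsize G = (total_size (left_options G) + total_size (right_options G)).+1.
Proof. by case: G. Qed.

Lemma gsize_gt0 G : (0 < gsize G)%N.
Proof. by rewrite gsizeE. Qed.

Lemma gsize_opp G : gsize (gopp G) = gsize G.
Proof.
elim/game_options_ind: G => G IHL IHR.
rewrite !gsizeE left_options_opp right_options_opp /total_size -!map_comp addnC.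
by congr (_ + _).+1; congr sumn; apply/eq_in_map => g gin /=; [exact: IHL|exact: IHR].
Qed.

Definition smallest (G : game) : Prop := forall H, geqv H G -> (gsize G <= gsize H)%N.

Lemma smallest_opp G : smallest G -> smallest (gopp G).
Proof.
move=> minG H eqH; rewrite gsize_opp -(gsize_opp H); apply: minG.
by rewrite -[G]goppK geqv_opp.
Qed.

Lemma smallest_exists G : exists2 C, smallest C & geqv C G.
Proof.
have [m] := ubnP (gsize G); elim: m G => // m IH G lt_m.
have [[H HG lt_H]|none] := pselect (exists2 H, geqv H G & (gsize H < gsize G)%N).
  have [|C minC CH] := IH H; first by lia.
  by exists C => //; exact: geqv_trans CH HG.
exists G; last exact: geqv_refl.
by move=> H HG; rewrite leqNgt; apply/negP => lt_H; apply: none; exists H.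
Qed.

Lemma total_size_cat2 s t : total_size (s ++ t) = (total_size s + total_size t)%N.
Proof. by rewrite /total_size map_cat sumn_cat. Qed.

Lemma total_size_cons g s : total_size (g :: s) = (gsize g + total_size s)%N.
Proof. by []. Qed.

Lemma pairwise_split (T : eqType) (r : rel T) (s : seq T) :
  (forall s1 x s2 y s3, s = s1 ++ x :: s2 ++ y :: s3 -> r x y) -> pairwise r s.
Proof.
elim: s => //= x s IH rs; apply/andP; split.
  apply/allP => y ys; clear IH; case/splitPr: ys rs => s2 s3 rs.
  exact: (rs [::] x s2 y s3).
by apply: IH => s1 y s2 z s3 sE; apply: (rs (x :: s1)); rewrite sE.
Qed.

Lemma smallest_no_domination L R : smallest (Game L R) ->
  pairwise (fun g h => ~~ gle g h && ~~ gle h g) L.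
Proof.
move=> minG; apply: pairwise_split => s1 x s2 y s3 LE.
have removal L' : {subset L' <= L} -> {in L, forall g, exists2 h, h \in L' & gle g h} ->
    (total_size L <= total_size L')%N.
  move=> subL domL; suff /minG : geqv (Game L' R) (Game L R) by rewrite !gsizeE /=; lia.
  rewrite /geqv; apply/andP; split; apply: gle_options => g gin /=.
  - by exists g; [exact: subL|exact: gle_refl].
  - by exists g; rewrite ?gle_refl.
  - exact: domL.
  - by exists g; rewrite ?gle_refl.
have sizes := (total_size_cat2, total_size_cons).
apply/andP; split; apply/negP => le_xy.
  have : (total_size L <= total_size (s1 ++ s2 ++ y :: s3))%N.
    apply: removal => [g|g]; rewrite LE !(mem_cat, inE).
      by case/or4P => ->; rewrite ?orbT.
    have [->|gx] := eqVneq g x => [_|gin]; first by exists y; rewrite // !(mem_cat, inE) eqxx ?orbT.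
    by exists g; rewrite ?gle_refl // !(mem_cat, inE).
  by rewrite LE !sizes; have := gsize_gt0 x; lia.
have : (total_size L <= total_size (s1 ++ x :: s2 ++ s3))%N.
  apply: removal => [g|g]; rewrite LE !(mem_cat, inE).
    by case/or4P => ->; rewrite ?orbT.
  have [->|gy] := eqVneq g y => [_|gin]; first by exists x; rewrite // !(mem_cat, inE) eqxx ?orbT.
  by exists g; rewrite ?gle_refl // !(mem_cat, inE).
by rewrite LE !sizes; have := gsize_gt0 y; lia.
Qed.

(** Bypassing a reversible option replaces it by the Left options of the
    reversing position, which is two levels deeper and so takes less room. *)
Lemma smallest_no_reversal L R : smallest (Game L R) ->
  {in L, forall g, {in right_options g, forall h, ~~ gle h (Game L R)}}.
Proof.
move=> minG g gin h hin; apply/negP => le_hG.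
case/splitPr: gin minG le_hG => s1 s2; set G := Game _ _ => minG le_hG.
pose G' := Game (s1 ++ left_options h ++ s2) R.
have le_hG' : gle h G'.
  apply/gleP; split=> [x xin|r rin].
    by apply: left_lf; rewrite /= !mem_cat xin orbT.
  by apply: contraNN (right_lf (rin : r \in right_options G)) => /gle_trans; apply.
have : geqv G' G.
  apply/andP; split; apply/gleP; split=> x xin;
    try exact: (@right_lf G' x xin); try exact: (@right_lf G x xin).
    move: xin; rewrite /= !mem_cat => /or3P[xin|xin|xin].
    - by apply: left_lf; rewrite /= mem_cat xin.
    - by apply: contraNN (left_lf xin); exact: gle_trans le_hG.
    - by apply: left_lf; rewrite /= mem_cat inE xin !orbT.
  move: xin; rewrite /= mem_cat inE => /or3P[xin|/eqP ->|xin].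
  - by apply: left_lf; rewrite /= !mem_cat xin.
  - by apply: contraNN (right_lf hin) => /(gle_trans le_hG').
  - by apply: left_lf; rewrite /= !mem_cat xin !orbT.
move=> /minG; have := gsize_right hin; have := gsizeE h.
rewrite [gsize G]gsizeE [gsize G']gsizeE /G /G' /= !(total_size_cat2, total_size_cons).
by lia.
Qed.

Lemma smallest_left L R g : smallest (Game L R) -> g \in L -> smallest g.
Proof.
move=> minG gin H eqH; case/splitPr: gin minG => s1 s2 minG.
have /minG : geqv (Game (s1 ++ H :: s2) R) (Game (s1 ++ g :: s2) R).
  have [le_Hg le_gH] := andP eqH; apply/andP; split; apply: gle_options => x;
    try by move=> xin; exists x; rewrite ?gle_refl.
    rewrite /= mem_cat inE => /or3P[xin|/eqP ->|xin].
    - by exists x; rewrite ?gle_refl // mem_cat xin.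
    - by exists g; rewrite // mem_cat mem_head orbT.
    - by exists x; rewrite ?gle_refl // mem_cat inE xin !orbT.
  rewrite /= mem_cat inE => /or3P[xin|/eqP ->|xin].
  - by exists x; rewrite ?gle_refl // mem_cat xin.
  - by exists H; rewrite // mem_cat mem_head orbT.
  - by exists x; rewrite ?gle_refl // mem_cat inE xin !orbT.
rewrite [gsize (Game _ _)]gsizeE [gsize (Game (_ ++ H :: _) _)]gsizeE /=.
by rewrite !(total_size_cat2, total_size_cons); lia.
Qed.

(** A dominated or reversible option could be removed or bypassed, which would
    give an equal but smaller game; and options of a smallest game are smallest.
    So minimality of the size takes the place of a reduction procedure. *)
Lemma smallest_canonical G : smallest G -> is_canonical G.
Proof.
elim/game_options_ind: G => -[L R] /= IHL IHR minG.
have minO : smallest (Game [seq gopp g | g <- R] [seq gopp g | g <- L]) := smallest_opp minG.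
apply/and5P; split; last (apply/andP; split).
- exact: smallest_no_domination minG.
- have := smallest_no_domination minO; rewrite pairwise_map.
  by apply: sub_pairwise => g h /=; rewrite !gle_oppC andbC.
- apply/allP => g gin; apply/allP => h hin.
  exact: smallest_no_reversal minG g gin h hin.
- apply/allP => g gin; apply/allP => h hin.
  have /(_ (gopp h)) := smallest_no_reversal minO (map_f gopp gin).
  rewrite mem_right_opp goppK -[Game [seq _ | _ <- R] _]/(gopp (Game L R)) gle_oppC.
  by apply.
- by apply/allP => g gin; apply: IHL => //; exact: smallest_left minG gin.
- apply/allP => g gin; apply: IHR => //; rewrite -[g]goppK; apply: smallest_opp.
  exact: smallest_left minO (map_f gopp gin).
Qed.

Lemma canonical_form_exists G : exists C, canonical_form G C.
Proof.
have [C minC CG] := smallest_exists G.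
by exists C; rewrite /canonical_form smallest_canonical.
Qed.

Lemma is_temperature_tau G : 0 < tau G -> is_temperature G (tau G).
Proof.
move=> t0; right; split.
  have := walls_gap (dyadic_nat 0) (lexx 0) t0; rewrite left_wall0 right_wall0.
  exact: stop_gap_not_number.
have [C canC] := canonical_form_exists G; exists C => //.
have /andP[_ CG] := canC; have [dt t0' tE tmin] := tau_least G.
have wallsE p : dyadic p -> 0 <= p -> left_stop (penalized C p) = left_wall G p /\
    right_stop (penalized C p) = right_wall G p.
  by move=> dp p0; rewrite -(left_wall_eqv CG) -?(right_wall_eqv CG).
split=> //; first by have [-> ->] := wallsE _ dt t0'.
by move=> q dq q0; have [-> ->] := wallsE q dq q0; exact: tmin.
Qed.

Lemma temperature_and_mean G t m : dyadic t -> 0 < t ->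
  left_wall G t = m -> right_wall G t = m ->
  (forall p, dyadic p -> 0 <= p -> p < t -> right_wall G p < left_wall G p) ->
  is_temperature G t /\ is_mean_value G m.
Proof.
move=> dt t0 lE rE gap.
have tE : tau G = t.
  apply: least_nonneg_dyadic_unique (tau_least G) _; split=> //; first exact: ltW.
    by rewrite lE rE.
  move=> q dq q0 E; rewrite leNgt; apply/negP => /(gap q dq q0).
  by rewrite E ltxx.
split; first by rewrite -tE; apply: is_temperature_tau; rewrite tE.
by rewrite -lE -tE; exact: mean_value_mast.
Qed.

(** * Robin Hood positions *)

Lemma mem_left_rh n a b i : (0 < i)%N -> (i <= n)%N -> (i <= a)%N ->
  robin_hood (n - i) a (b - i) \in left_options (robin_hood n a b).
Proof.
move=> i0 le_in le_ia; rewrite [robin_hood n a b]robin_hoodE /=; apply/mapP; exists i => //.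
by rewrite mem_iota add1n ltnS leq_min i0 le_in.
Qed.

Lemma mem_right_rh n a b j : (0 < j)%N -> (j <= n)%N -> (j <= b)%N ->
  robin_hood (n - j) (a - j) b \in right_options (robin_hood n a b).
Proof.
move=> j0 le_jn le_jb; rewrite [robin_hood n a b]robin_hoodE /=; apply/mapP; exists j => //.
by rewrite mem_iota add1n ltnS leq_min j0 le_jn.
Qed.

Lemma left_rh_inv n a b g : g \in left_options (robin_hood n a b) ->
  exists i, [/\ (0 < i)%N, (i <= n)%N, (i <= a)%N & g = robin_hood (n - i) a (b - i)].
Proof.
rewrite robin_hoodE /= => /mapP[i]; rewrite mem_iota add1n ltnS leq_min => /and3P[? ? ?] ->.
by exists i.
Qed.

Lemma right_rh_inv n a b g : g \in right_options (robin_hood n a b) ->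
  exists j, [/\ (0 < j)%N, (j <= n)%N, (j <= b)%N & g = robin_hood (n - j) (a - j) b].
Proof.
rewrite robin_hoodE /= => /mapP[i]; rewrite mem_iota add1n ltnS leq_min => /and3P[? ? ?] ->.
by exists i.
Qed.

Lemma robin_hood_opp n a b : gopp (robin_hood n a b) = robin_hood n b a.
Proof.
have [m] := ubnP n; elim: m n a b => // m IH n a b lt_m.
rewrite [robin_hood n a b]robin_hoodE [RHS]robin_hoodE /= -!map_comp.
by congr Game; apply/eq_in_map => i; rewrite mem_iota /= => /andP[? ?]; apply: IH; lia.
Qed.

Lemma robin_hood_le n a b a' b' : (a <= a')%N -> (b' <= b)%N ->
  gle (robin_hood n a b) (robin_hood n a' b').
Proof.
have [m] := ubnP n; elim: m n a b a' b' => // m IH n a b a' b' lt_m le_a le_b.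
apply: gle_options => g.
  move=> /left_rh_inv[i [i0 le_in le_ia ->]]; exists (robin_hood (n - i) a' (b' - i)).
    by apply: mem_left_rh => //; exact: leq_trans le_a.
  by apply: IH; lia.
move=> /right_rh_inv[i [i0 le_in le_ib ->]]; exists (robin_hood (n - i) (a - i) b).
  by apply: mem_right_rh => //; exact: leq_trans le_b.
by apply: IH; lia.
Qed.

Lemma robin_hood_left_alone n a : (0 < a)%N -> equals_dyadic (robin_hood n a 0) n%:R.
Proof.
move=> a0; split; first exact: dyadic_nat.
rewrite -[n%:R]/(n%:Z%:~R) number_game_int.
have [m] := ubnP n; elim: m n => // m IH n lt_m.
rewrite /geqv; apply/andP; split; apply: gle_options => g.
- move=> /left_rh_inv[i [i0 le_in le_ia ->]]; exists (integer_game (n%:Z - 1)).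
    by rewrite left_options_integer (_ : 0 < n%:Z) ?mem_head //; lia.
  rewrite sub0n; have /andP[le_i _] := IH (n - i)%N (ltac:(lia)).
  apply: gle_trans le_i _.
  by rewrite -[gle _ _]/(gle (dyadic_game 0 _) (dyadic_game 0 _)) dyadic_game_le; lia.
- by rewrite right_options_integer.
- rewrite left_options_integer; case: ifP => // n0; rewrite inE => /eqP ->.
  exists (robin_hood (n - 1) a (0 - 1)); first by apply: mem_left_rh; lia.
  have /andP[_] := IH (n - 1)%N (ltac:(lia)).
  by rewrite (_ : (n - 1)%N%:Z = n%:Z - 1) //; lia.
by move=> /right_rh_inv[j [j0 _ + _]]; lia.
Qed.

Lemma robin_hood_right_alone n b : (0 < b)%N -> equals_dyadic (robin_hood n 0 b) (- n%:R).
Proof.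
by move=> b0; rewrite -robin_hood_opp; exact/equals_dyadic_opp/robin_hood_left_alone.
Qed.

Lemma left_wall_rh n a b p :
  left_wall (robin_hood n a b) p = - right_wall (robin_hood n b a) p.
Proof. by rewrite -left_wall_opp robin_hood_opp. Qed.

Lemma right_wall_rh n a b p :
  right_wall (robin_hood n a b) p = - left_wall (robin_hood n b a) p.
Proof. by rewrite -right_wall_opp robin_hood_opp. Qed.

Lemma right_wall_kill n a b p : dyadic p -> 0 <= p ->
  (0 < a)%N -> (a <= b)%N -> (a <= n)%N ->
  right_wall (robin_hood n a b) p <= - (n%:R - a%:R) + p.
Proof.
move=> dp p0 a0 le_ab le_an.
have := right_wall_le_option dp p0 (mem_right_rh a a0 le_an le_ab); rewrite subnn.
have [-> _] := walls_number (@robin_hood_right_alone (n - a) b (leq_trans a0 le_ab)) p0.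
by rewrite natrB.
Qed.

Lemma left_wall_kill n a b p : dyadic p -> 0 <= p ->
  (0 < b)%N -> (b <= a)%N -> (b <= n)%N ->
  n%:R - b%:R - p <= left_wall (robin_hood n a b) p.
Proof.
move=> dp p0 b0 le_ba le_bn; rewrite left_wall_rh lerNr.
by apply: le_trans (right_wall_kill dp p0 b0 le_ba le_bn) _; lra.
Qed.

(** While [p <= a], nothing is worth more to Right, moving first, than
    ruining Left outright: a lesser move leaves Left a position with the same
    surplus [n - a], and if Right's move is not urgent then Left's own best
    theft already secures the bound. *)
Lemma right_wall_ge n a b p : (0 < a)%N -> (0 < b)%N -> (2 * (a + b) <= n)%N ->
  dyadic p -> 0 <= p -> p <= a%:R ->
  - (n%:R - a%:R) + p <= right_wall (robin_hood n a b) p.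
Proof.
have [m] := ubnP (a + b)%N; elim: m n a b p => // m IH n a b p lt_m a0 b0 le_n dp p0 le_pa.
have nR : (2 * (a%:R + b%:R) <= n%:R :> rat) by rewrite -natrD -natrM ler_nat.
have a0R : 0 < a%:R :> rat by rewrite ltr0n.
have [gap|] := boolP (right_wall (robin_hood n a b) p < left_wall (robin_hood n a b) p).
  have [_ [g /right_rh_inv[j [j0 le_jn le_jb ->]] ->]] := wall_gap_attained dp p0 gap.
  rewrite lerD2r; have [le_aj|lt_ja] := leqP a j.
    have -> : (a - j)%N = 0%N by lia.
    have [-> _] := walls_number (@robin_hood_right_alone (n - j) b b0) p0.
    by rewrite natrB // lerN2 lerD2l lerN2 ler_nat.
  have djR : (a - j)%:R = a%:R - j%:R :> rat by rewrite natrB // ltnW.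
  have dnR : (n - j)%:R = n%:R - j%:R :> rat by rewrite natrB.
  have da := dyadic_nat (a - j).
  (* The induction hypothesis holds only up to the tax [a - j]; the Right wall
     does not decrease beyond it. *)
  pose q := Num.min p (a - j)%:R; have dq : dyadic q by exact: dyadic_minr.
  have q0 : 0 <= q by rewrite le_min p0 ler0n.
  apply: le_trans (right_wall_le_left _ _).
  apply: le_trans _ (right_wall_homo _ dq dp q0 _); last by rewrite ge_min lexx.
  apply: le_trans (IH _ _ _ q _ _ b0 _ dq q0 _); try lia.
    by rewrite djR dnR; lra.
  by rewrite ge_min lexx orbT.
rewrite -leNgt => no_gap; apply: le_trans no_gap.
have [le_ba|lt_ab] := leqP b a.
  have b0R : 0 < b%:R :> rat by rewrite ltr0n.
  by apply: le_trans _ (left_wall_kill dp p0 b0 le_ba _); [lra|lia].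
have le_an : (a <= n)%N by lia.
have := left_wall_ge_option dp p0 (mem_left_rh b a0 le_an (leqnn a)).
have := IH (n - a)%N a (b - a)%N p (ltac:(lia)) a0 (ltac:(lia)) (ltac:(lia)) dp p0 le_pa.
by rewrite natrB //; lra.
Qed.

Lemma right_wall_ge_surplus n a b p : (0 < b)%N -> (2 * (a + b) <= n)%N -> dyadic p -> 0 <= p ->
  - (n%:R - a%:R) <= right_wall (robin_hood n a b) p.
Proof.
move=> b0 le_n dp p0; have [-> | a0] := posnP a.
  by have [_ ->] := walls_number (@robin_hood_right_alone n b b0) p0; lra.
have d0 : dyadic 0 := dyadic_nat 0.
apply: le_trans (right_wall_homo _ d0 dp (lexx 0) p0).
by apply: le_trans (right_wall_ge a0 b0 le_n d0 (lexx 0) (ler0n _ _)); lra.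
Qed.

Lemma right_reply_ge n a b j p : (0 < j)%N -> (j <= n)%N -> (j <= b)%N ->
  (2 * (a + b) <= n)%N -> dyadic p -> 0 <= p ->
  - (n%:R - a%:R) <= left_wall (robin_hood (n - j) (a - j) b) p.
Proof.
move=> j0 le_jn le_jb le_n dp p0; apply: le_trans (right_wall_le_left _ _).
have b0 : (0 < b)%N by lia.
have [le_ja|lt_aj] := leqP j a.
  apply: le_trans (right_wall_ge_surplus b0 _ dp p0); last by lia.
  by rewrite !natrB //; lra.
have -> : (a - j)%N = 0%N by lia.
have [_ ->] := walls_number (@robin_hood_right_alone (n - j) b b0) p0.
by rewrite natrB // lerN2 lerD2l lerN2 ler_nat ltnW.
Qed.

Lemma left_reply_le n a b i p : (0 < i)%N -> (i <= n)%N -> (i <= a)%N ->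
  (2 * (a + b) <= n)%N -> dyadic p -> 0 <= p ->
  right_wall (robin_hood (n - i) a (b - i)) p <= n%:R - b%:R.
Proof.
move=> i0 le_in le_ia le_n dp p0; rewrite right_wall_rh lerNl.
by apply: right_reply_ge => //; rewrite addnC.
Qed.

(** * Pingala sequences *)

Definition fib_like (U : nat -> nat) : Prop :=
  [/\ forall k, (0 < U k)%N, (U 1 <= U 0)%N & forall k, U k.+2 = (U k.+1 + U k)%N].

Lemma fib_like_mono U j k : fib_like U -> (0 < j)%N -> (j <= k)%N -> (U j <= U k)%N.
Proof.
move=> [U0 U10 UE] j0 /subnK <-; elim: (k - j)%N => // d /leq_trans; apply.
by rewrite addSn; case: (d + j)%N (leq_trans j0 (leq_addl d j)) => // i _; rewrite UE leq_addr.
Qed.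

Lemma fib_like_U0 U k : fib_like U -> (U 0%N < U k.+2)%N.
Proof.
move=> hU; apply: leq_trans (fib_like_mono (j := 2) (k := k.+2) hU _ _) => //.
by have [U0 _ ->] := hU; rewrite -[X in (X < _)%N]add0n ltn_add2r.
Qed.

Lemma reply_ruin n a b i p : dyadic p -> 0 <= p -> (0 < a)%N ->
  (i + a <= b)%N -> (i + a <= n)%N ->
  right_wall (robin_hood (n - i) a (b - i)) p <= - (n%:R - i%:R - a%:R) + p.
Proof.
move=> dp p0 a0 le_b le_n; have := @right_wall_kill (n - i) a (b - i) p dp p0 a0.
by rewrite natrB; [apply; lia|lia].
Qed.

(** Right can answer a theft of [i] by stealing [b - i]. The heap is then [n - b]
    whatever [i] was, and of the positions reached in this way the one with
    [i = a] is the best for Left. *)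
Lemma reply_equalize n a b i p : dyadic p -> 0 <= p ->
  (i <= a)%N -> (a <= b)%N -> (i < b)%N -> (b <= n)%N ->
  right_wall (robin_hood (n - i) a (b - i)) p <=
  left_wall (robin_hood (n - b) (a - (b - a)) (b - a)) p + p.
Proof.
move=> dp p0 le_ia le_ab lt_ib le_bn.
have := @mem_right_rh (n - i) a (b - i) (b - i).
rewrite subn_gt0 lt_ib leqnn => /(_ isT (ltac:(lia)) isT).
move=> /(right_wall_le_option dp p0)/le_trans; apply; rewrite lerD2r.
have -> : (n - i - (b - i))%N = (n - b)%N by lia.
have le_G : gle (robin_hood (n - b) (a - (b - i)) (b - i))
    (robin_hood (n - b) (a - (b - a)) (b - a)) by apply: robin_hood_le; lia.
by have [] := walls_le le_G dp p0.
Qed.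

Definition pingala_pos (U : nat -> nat) (n k : nat) : game := robin_hood n (U k) (U k.+1).

Lemma reply_pos U n k i p : fib_like U -> dyadic p -> 0 <= p ->
  (i <= U k.+2)%N -> (U k.+3 <= n)%N ->
  right_wall (robin_hood (n - i) (U k.+2) (U k.+3 - i)) p <=
  left_wall (pingala_pos U (n - U k.+3) k) p + p.
Proof.
move=> [U0 U10 UE] dp p0 le_i le_n.
have := UE k; have := UE k.+1; have := U0 k.+1; have := U0 k => ? ? ? ?.
have := @reply_equalize n (U k.+2) (U k.+3) i p dp p0 le_i.
rewrite (_ : U k.+2 - (U k.+3 - U k.+2) = U k)%N; last by lia.
rewrite (_ : U k.+3 - U k.+2 = U k.+1)%N; last by lia.
by apply; lia.
Qed.

(** The quantity [U_k - U_0] carries all the formulas: at an odd index [k] the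
    temperature is the gap of [k + 1], and the mast is the gap of [k + 2] minus
    the heap. *)
Definition pingala_gap (U : nat -> nat) (k : nat) : rat := (U k)%:R - (U 0%N)%:R.

Lemma gap_dyadic U k : dyadic (pingala_gap U k).
Proof. by apply: dyadicB; exact: dyadic_nat. Qed.

Lemma gap_ge0 U k : fib_like U -> 0 <= pingala_gap U k.+2.
Proof. by move=> hU; rewrite subr_ge0 ler_nat ltnW // fib_like_U0. Qed.

Lemma gap_le U k : fib_like U -> pingala_gap U k.+1 <= pingala_gap U k.+2.
Proof. by move=> hU; rewrite lerD2r ler_nat fib_like_mono. Qed.

Lemma fib_likeR U k : fib_like U ->
  [/\ (U k.+2)%:R = (U k.+1)%:R + (U k)%:R :> rat, 1 <= (U k)%:R :> rat
    & (U 0%N)%:R <= (U k.+2)%:R :> rat].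
Proof.
move=> hU; have [U0 _ UE] := hU; rewrite UE natrD; split=> //.
  by rewrite ler1n.
by rewrite -natrD -UE ler_nat ltnW // fib_like_U0.
Qed.

(** At an odd index the rich Right need not fear Left's thefts: each is answered,
    either by ruin or by the exchange that leads two steps down the sequence,
    where the bound on the mast is the same. *)
Lemma left_wall_pos_odd U m n : fib_like U -> (U m.*2.+3 <= n)%N ->
  left_wall (pingala_pos U n m.*2.+1) (pingala_gap U m.*2.+2) <= - (n%:R - pingala_gap U m.*2.+3).
Proof.
move=> hU; have [Upos U10 UE] := hU.
have step k n' : (U 0%N <= U k)%N -> (U k.+3 <= n')%N ->
    (forall i, (i <= U k.+1)%N -> (U k.+2 < i + U k.+1)%N ->
       right_wall (robin_hood (n' - i) (U k.+1) (U k.+2 - i)) (pingala_gap U k.+2) -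
         pingala_gap U k.+2 <= - (n'%:R - pingala_gap U k.+3)) ->
    left_wall (pingala_pos U n' k.+1) (pingala_gap U k.+2) <= - (n'%:R - pingala_gap U k.+3).
  move=> le_U0 le_n large.
  have dp := gap_dyadic U k.+2; have p0 := gap_ge0 k hU.
  have [u3 _ _] := fib_likeR k.+1 hU; have UE1 := UE k.+1; have UE0 := UE k.
  have [gap|] := boolP (right_wall (pingala_pos U n' k.+1) (pingala_gap U k.+2) <
                        left_wall (pingala_pos U n' k.+1) (pingala_gap U k.+2)); last first.
    rewrite -leNgt => /le_trans; apply.
    apply: le_trans (right_wall_kill dp p0 (Upos _) _ _) _; [lia|lia|].
    by rewrite /pingala_gap u3; lra.
  have [[g /left_rh_inv[i [i0 le_in le_ia ->]] ->] _] := wall_gap_attained dp p0 gap.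
  have [le_i|lt_i] := leqP (i + U k.+1) (U k.+2); last exact: large.
  rewrite lerBlDr; apply: le_trans (reply_ruin dp p0 (Upos _) le_i _) _; first by lia.
  rewrite lerD2r /pingala_gap u3.
  have : i%:R <= (U k.+2)%:R - (U 0%N)%:R :> rat.
    by rewrite lerBrDr -natrD ler_nat; lia.
  by lra.
elim: m n => [|m IH] n le_n.
  by apply: (step 0%N) => // i le_i; have := UE 0%N; lia.
have U0le : (U 0%N <= U m.*2.+2)%N by apply/ltnW/fib_like_U0.
rewrite doubleS; apply: step => // i le_i _.
have := UE m.*2.+3; have := UE m.*2.+2; have := UE m.*2.+1 => UE1 UE2 UE3.
rewrite doubleS in le_n.
have dp := gap_dyadic U m.*2.+4; have p0 := gap_ge0 m.*2.+2 hU.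
rewrite lerBlDr; apply: le_trans (reply_pos hU dp p0 le_i _) _; first by lia.
rewrite lerD2r; have le_gap : pingala_gap U m.*2.+2 <= pingala_gap U m.*2.+4.
  exact: le_trans (gap_le _ hU) (gap_le _ hU).
apply: le_trans (left_wall_anti _ (gap_dyadic _ _) dp (gap_ge0 _ hU) le_gap) _.
apply: le_trans (IH _ _) _; first by lia.
rewrite natrB; last by lia.
by have [u5 _ _] := fib_likeR m.*2.+3 hU; rewrite /pingala_gap u5; lra.
Qed.

(** Let [a = U_(k+2)] and [b = U_(k+3)]. At the tax [a - U_0] the position after
    a theft either has its walls together, and then Right's reply towards the
    position two steps down bounds them, or its Left wall comes from a second
    theft, which is worth at most [n - b] before tax. Both bounds are the same. *)
Lemma theft_value_le U k n i p : fib_like U -> (0 < i)%N -> (i <= U k.+2)%N ->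
  (4 * U k.+4 <= n)%N -> dyadic p -> pingala_gap U k.+2 <= p ->
  left_wall (pingala_pos U (n - U k.+3) k) (pingala_gap U k.+2) <=
    (n - U k.+3)%:R - pingala_gap U k.+2 - pingala_gap U k.+2 ->
  right_wall (robin_hood (n - i) (U k.+2) (U k.+3 - i)) p <= n%:R - pingala_gap U k.+4.
Proof.
move=> hU i0 le_i le_n dp le_p IH; have [Upos U10 UE] := hU.
have UE1 := UE k.+1; have UE2 := UE k.+2; have UE0 := UE k.
have dq := gap_dyadic U k.+2; have q0 := gap_ge0 k hU.
have [u4 _ _] := fib_likeR k.+2 hU.
apply: le_trans (right_wall_le_left _ _) _.
apply: le_trans (left_wall_anti _ dq dp q0 le_p) _.
set g := robin_hood _ _ _.
have [gap|] := boolP (right_wall g (pingala_gap U k.+2) <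
                      left_wall g (pingala_gap U k.+2)); last first.
  rewrite -leNgt => /le_trans; apply.
  apply: le_trans (reply_pos hU dq q0 le_i _) _; first by lia.
  rewrite -lerBrDr; apply: le_trans IH _; rewrite natrB; last by lia.
  by rewrite /pingala_gap u4; lra.
have [[h /left_rh_inv[j [j0 le_jn le_ja ->]] ->] _] := wall_gap_attained dq q0 gap.
rewrite lerBlDr; apply: le_trans (left_reply_le j0 le_jn le_ja _ dq q0) _.
  by have := leq_subr i (U k.+3); lia.
have : (U k.+3)%:R <= i%:R + (U k.+3 - i)%:R :> rat by rewrite -natrD ler_nat; lia.
have -> : (n - i)%:R = n%:R - i%:R :> rat by rewrite natrB //; lia.
by rewrite /pingala_gap u4; lra.
Qed.

(** With the players exchanged, this is the position that Left reaches by the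
    best theft from the next index, taken at the temperature of that index. The
    Left wall lies there on or below its line of slope [- 1], which is what
    keeps Left's theft a threat. *)
Lemma left_wall_pos_even U m n : fib_like U -> (4 * U m.*2.+2 <= n)%N ->
  left_wall (pingala_pos U n m.*2) (pingala_gap U m.*2.+2) <=
  n%:R - pingala_gap U m.*2.+2 - pingala_gap U m.*2.+2.
Proof.
move=> hU; have [Upos U10 UE] := hU; elim: m n => [|m IH] n le_n.
  rewrite double0 in le_n *.
  have -> : pingala_gap U 2 = (U 1%N)%:R by rewrite /pingala_gap UE natrD addrK.
  have UE0 := UE 0%N; have := dyadic_nat (U 1%N); have := ler0n rat (U 1%N) => d1 p1.
  rewrite left_wall_rh lerNl.
  by apply: le_trans (right_wall_ge (Upos _) (Upos _) _ p1 d1 (lexx _)); [lra|lia].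
rewrite doubleS in le_n *.
have UE3 := UE m.*2.+2; have UE2 := UE m.*2.+1; have UE1 := UE m.*2.
have dp := gap_dyadic U m.*2.+4; have p0 := gap_ge0 m.*2.+2 hU.
have [u4 u2 _] := fib_likeR m.*2.+2 hU; have [_ u3 u03] := fib_likeR m.*2.+1 hU.
have nR : 4 * (U m.*2.+4)%:R <= n%:R :> rat by rewrite -natrM ler_nat.
have [_ u0 _] := fib_likeR 0 hU.
have [gap|] := boolP (right_wall (pingala_pos U n m.*2.+2) (pingala_gap U m.*2.+4) <
                      left_wall (pingala_pos U n m.*2.+2) (pingala_gap U m.*2.+4)); last first.
  rewrite -leNgt => /le_trans; apply.
  apply: le_trans (right_wall_kill dp p0 (Upos _) _ _) _; [lia|lia|].
  by rewrite /pingala_gap; lra.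
have [[g /left_rh_inv[i [i0 le_in le_ia ->]] ->] _] := wall_gap_attained dp p0 gap.
rewrite lerD2r.
have [le_i|lt_i] := leqP (i + U m.*2.+2) (U m.*2.+3).
  apply: le_trans (reply_ruin dp p0 (Upos _) le_i _) _; first by lia.
  have : i%:R <= (U m.*2.+2)%:R :> rat by rewrite ler_nat.
  by rewrite /pingala_gap; lra.
apply: theft_value_le => //.
  exact: le_trans (gap_le _ hU) (gap_le _ hU).
by apply: IH; lia.
Qed.

(** * Temperatures of Robin Hood positions *)

(** The foot of the mast, together with the proof that it is the foot. *)
Definition freezes (G : game) (t m : rat) : Prop :=
  [/\ dyadic t, 0 < t, left_wall G t = m, right_wall G t = m
    & forall p, dyadic p -> 0 <= p -> p < t -> right_wall G p < left_wall G p].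

Lemma freezes_temperature_mean G t m : freezes G t m ->
  is_temperature G t /\ is_mean_value G m.
Proof. by case=> dt t0 lE rE gap; exact: temperature_and_mean. Qed.

Lemma freezes_opp G t m : freezes G t m -> freezes (gopp G) t (- m).
Proof.
case=> dt t0 lE rE gap; split=> //.
- by rewrite left_wall_opp rE.
- by rewrite right_wall_opp lE.
by move=> p dp p0 lt_p; rewrite left_wall_opp right_wall_opp ltrN2; exact: gap.
Qed.

(** As long as its Right wall is attained by a move, no move of Right beats the
    ruin of Left. *)
Lemma right_wall_gap_ge n a b p : (2 * (a + b) <= n)%N -> dyadic p -> 0 <= p ->
  right_wall (robin_hood n a b) p < left_wall (robin_hood n a b) p ->
  - (n%:R - a%:R) + p <= right_wall (robin_hood n a b) p.
Proof.
move=> le_n dp p0 /(wall_gap_attained dp p0)[_ [g /right_rh_inv[j [j0 le_jn le_jb ->]] ->]].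
by rewrite lerD2r; exact: right_reply_ge.
Qed.

(** The foot of the mast is where Right's option of ruin, a wall of slope [1],
    meets the vertical Left wall that Left's sente theft provides. *)
Lemma freezes_odd U m n : fib_like U -> (4 * U m.*2.+3 <= n)%N ->
  freezes (pingala_pos U n m.*2.+1) (pingala_gap U m.*2.+2) (- (n%:R - pingala_gap U m.*2.+3)).
Proof.
move=> hU le_n; have [Upos U10 UE] := hU; set G := pingala_pos _ _ _.
set t := pingala_gap U m.*2.+2; set v := - _.
have UE1 := UE m.*2.+1; have UE0 := UE m.*2; have Up0 := Upos m.*2; have Up1 := Upos m.*2.+1.
have le_ab : (U m.*2.+1 <= U m.*2.+2)%N by lia.
have le_an : (U m.*2.+1 <= n)%N by lia.
have le_sum : (2 * (U m.*2.+1 + U m.*2.+2) <= n)%N by lia.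
have le_small : (U m.*2.+3 <= n)%N by lia.
have le_rest : (4 * U m.*2.+2 <= n - U m.*2.+1)%N by lia.
have subU : (U m.*2.+2 - U m.*2.+1 = U m.*2)%N by lia.
have [u3 u1 _] := fib_likeR m.*2.+1 hU; have [u2 u0 u02] := fib_likeR m.*2 hU.
have dt : dyadic t := gap_dyadic _ _.
have t0 : 0 < t by rewrite subr_gt0 ltr_nat fib_like_U0.
have kill p : dyadic p -> 0 <= p -> right_wall G p <= v - (t - p).
  move=> dp p0; apply: le_trans (right_wall_kill dp p0 Up1 le_ab le_an) _.
  by rewrite /v /t /pingala_gap u3; lra.
have le_v : left_wall G t <= v by exact: left_wall_pos_odd.
have v_le : v <= left_wall G t.
  apply: le_trans (left_wall_ge_option dt (ltW t0) (mem_left_rh _ Up1 le_an (leqnn _))).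
  rewrite subU right_wall_rh lerBrDr lerNr.
  apply: le_trans (left_wall_pos_even hU le_rest) _.
  by rewrite natrB // /v /t /pingala_gap u3; lra.
have lE : left_wall G t = v by apply: le_anti; rewrite le_v v_le.
split=> //.
  apply: le_anti; have := kill t dt (ltW t0); rewrite subrr subr0 => -> /=.
  have [gap|] := boolP (right_wall G t < left_wall G t); last by rewrite -leNgt lE.
  apply: le_trans (right_wall_gap_ge le_sum dt (ltW t0) gap).
  by rewrite /v /t /pingala_gap u3; lra.
move=> p dp p0 lt_p; apply: le_lt_trans (kill p dp p0) _.
by apply: lt_le_trans (left_wall_anti _ dp dt p0 (ltW lt_p)); rewrite lE; lra.
Qed.

(** Left's theft gives a Left wall of slope [- 1] and Right's option of ruin a
    Right wall of slope [1]; they meet at a tax that grows with the heap. *)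
Lemma freezes_even U m n : fib_like U -> (4 * U m.*2.+4 <= n)%N ->
  freezes (pingala_pos U n m.*2.+2)
    (n%:R - (U m.*2.+2)%:R + ((U 0%N)%:R - (U m.*2.+3)%:R) / 2)
    (((U 0%N)%:R - (U m.*2.+3)%:R) / 2).
Proof.
move=> hU le_n; have [Upos U10 UE] := hU; set G := pingala_pos _ _ _.
set t := n%:R - _ + _; set v := _ / 2.
have UE2 := UE m.*2.+2; have UE1 := UE m.*2.+1; have UE0 := UE m.*2.
have Up2 := Upos m.*2.+2; have Up1 := Upos m.*2.+1.
have le_ab : (U m.*2.+2 <= U m.*2.+3)%N by lia.
have le_an : (U m.*2.+2 <= n)%N by lia.
have le_sum : (2 * (U m.*2.+2 + U m.*2.+3) <= n)%N by lia.
have le_rest : (U m.*2.+3 <= n - U m.*2.+2)%N by lia.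
have le_rest' : (4 * U m.*2.+2 <= n - U m.*2.+3)%N by lia.
have le_ruin i : (i + U m.*2.+2 <= U m.*2.+3)%N -> (i + U m.*2.+2 <= n)%N by lia.
have subU : (U m.*2.+3 - U m.*2.+2 = U m.*2.+1)%N by lia.
have [u4 u2 _] := fib_likeR m.*2.+2 hU; have [u3 u1 u03] := fib_likeR m.*2.+1 hU.
have [_ u0 u02] := fib_likeR m.*2 hU; have [_ u00 _] := fib_likeR 0 hU.
have nR : 4 * (U m.*2.+4)%:R <= n%:R :> rat by rewrite -natrM ler_nat.
have dv : dyadic v by apply/dyadic_half/dyadicB; exact: dyadic_nat.
have dt : dyadic t by apply: dyadicD => //; apply: dyadicB; exact: dyadic_nat.
have ds : dyadic (pingala_gap U m.*2.+2) := gap_dyadic _ _.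
have s0 : 0 <= pingala_gap U m.*2.+2 := gap_ge0 _ hU.
have st : pingala_gap U m.*2.+2 < t by rewrite /t /pingala_gap; lra.
have t0 : 0 < t by exact: le_lt_trans st.
have kill p : dyadic p -> 0 <= p -> right_wall G p <= - (n%:R - (U m.*2.+2)%:R) + p.
  by move=> dp p0; exact: right_wall_kill.
have theft p : dyadic p -> pingala_gap U m.*2.+2 <= p ->
    n%:R - pingala_gap U m.*2.+4 - p <= left_wall G p.
  move=> dp sp; have p0 := le_trans s0 sp.
  apply: le_trans (left_wall_ge_option dp p0 (mem_left_rh _ Up2 le_an (leqnn _))).
  rewrite subU right_wall_rh lerD2r lerNr; apply: le_trans (left_wall_anti _ ds dp s0 sp) _.
  apply: le_trans (left_wall_pos_odd hU le_rest) _.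
  by rewrite natrB // /pingala_gap u4; lra.
have v_le : v <= left_wall G t.
  apply: le_trans (theft t dt (ltW st)); rewrite /v /t /pingala_gap u4; lra.
have le_v : right_wall G t <= v.
  by apply: le_trans (kill t dt (ltW t0)) _; rewrite /v /t; lra.
have [gap|no_gap] := boolP (right_wall G t < left_wall G t); last first.
  rewrite -leNgt in no_gap.
  have lE : left_wall G t = v by apply: le_anti; rewrite v_le (le_trans no_gap).
  have rE : right_wall G t = v by apply: le_anti; rewrite le_v (le_trans v_le).
  split=> // p dp p0 lt_p.
  have [le_sp|lt_ps] := leP (pingala_gap U m.*2.+2) p.
    apply: le_lt_trans (kill p dp p0) _; apply: lt_le_trans (theft p dp le_sp).
    by move: lt_p; rewrite /t /pingala_gap u4; lra.
  apply: le_lt_trans (kill p dp p0) _.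
  apply: lt_le_trans (left_wall_anti _ dp ds p0 (ltW lt_ps)).
  apply: lt_le_trans (theft _ ds (lexx _)).
  by move: st lt_ps; rewrite /t /pingala_gap u4; lra.
(* Were the walls still apart at [t], both would be attained by moves, and the
   bounds on all moves would bring them together. *)
exfalso; have : v <= right_wall G t.
  apply: le_trans (right_wall_gap_ge le_sum dt (ltW t0) gap).
  by rewrite /v /t; lra.
suff : left_wall G t <= v by move: gap; lra.
have [[g /left_rh_inv[i [i0 le_in le_ia ->]] ->] _] := wall_gap_attained dt (ltW t0) gap.
rewrite lerBlDr; have [le_i|lt_i] := leqP (i + U m.*2.+2) (U m.*2.+3).
  apply: le_trans (reply_ruin dt (ltW t0) Up2 le_i (le_ruin i le_i)) _.
  have : i%:R <= (U m.*2.+2)%:R :> rat by rewrite ler_nat.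
  by rewrite lerD2r /v; lra.
apply: le_trans (theft_value_le hU i0 le_ia le_n dt (ltW st) _) _.
  exact: left_wall_pos_even.
by rewrite /v /t /pingala_gap u4; lra.
Qed.

Lemma freezes_equal n a : (0 < a)%N -> (4 * a <= n)%N ->
  freezes (robin_hood n a a) (n%:R - a%:R) 0.
Proof.
move=> a0 le_n; set t := _ - _; set G := robin_hood _ _ _.
have le_an : (a <= n)%N by lia.
have lt_an : (a < n)%N by lia.
have le_sum : (2 * (a + a) <= n)%N by lia.
have dt : dyadic t by apply: dyadicB; exact: dyadic_nat.
have t0 : 0 < t by rewrite subr_gt0 ltr_nat.
have killR p : dyadic p -> 0 <= p -> right_wall G p <= - t + p.
  by move=> dp p0; apply: right_wall_kill.
have killL p : dyadic p -> 0 <= p -> t - p <= left_wall G p.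
  by move=> dp p0; apply: left_wall_kill.
have := killR t dt (ltW t0); have := killL t dt (ltW t0); rewrite subrr addNr => l0 r0.
have [gap|no_gap] := boolP (right_wall G t < left_wall G t).
  have := right_wall_gap_ge le_sum dt (ltW t0) gap; rewrite -/t addNr -/G => r0'.
  have [[g /left_rh_inv[i [i0 le_in le_ia ->]] lE] _] := wall_gap_attained dt (ltW t0) gap.
  have := left_reply_le (b := a) i0 le_in le_ia le_sum dt (ltW t0).
  by move: gap; rewrite lE -/t; lra.
rewrite -leNgt in no_gap.
split=> //; try by apply: le_anti; apply/andP; split; lra.
by move=> p dp p0 lt_p; have := killR p dp p0; have := killL p dp p0; lra.
Qed.

(** * Positions with a large heap are hot *)

Lemma left_wall_le_heap n a b p : dyadic p -> 0 <= p ->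
  left_wall (robin_hood n a b) p <= n%:R.
Proof.
move=> dp p0; have le_G : gle (robin_hood n a b) (robin_hood n a.+1 0).
  exact: robin_hood_le.
have [le_l _] := walls_le le_G dp p0; apply: le_trans le_l _.
by have [-> _] := walls_number (robin_hood_left_alone n (ltn0Sn a)) p0.
Qed.

(** Whoever moves first, at least one coin is gone before Left can use the rest
    of the heap for free moves. *)
Lemma left_wall_lt_heap n a b : (0 < n)%N -> (0 < b)%N ->
  left_wall (robin_hood n a b) 0 <= n%:R - 1.
Proof.
move=> n0 b0; have d0 : dyadic 0 := dyadic_nat 0.
have predn i : (0 < i)%N -> (i <= n)%N -> (n - i)%:R <= n%:R - 1 :> rat.
  by move=> i0 le_in; rewrite natrB // lerD2l lerN2 ler1n.
have [gap|] := boolP (right_wall (robin_hood n a b) 0 < left_wall (robin_hood n a b) 0).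
  have [[g /left_rh_inv[i [i0 le_in le_ia ->]] ->] _] := wall_gap_attained d0 (lexx 0) gap.
  rewrite subr0; apply: le_trans (right_wall_le_left _ _) _.
  exact: le_trans (left_wall_le_heap _ _ _ d0 (lexx 0)) (predn i i0 le_in).
rewrite -leNgt => /le_trans; apply.
have := right_wall_le_option d0 (lexx 0) (mem_right_rh a (ltn0Sn 0) n0 b0).
rewrite addr0 => /le_trans; apply.
exact: le_trans (left_wall_le_heap _ _ _ d0 (lexx 0)) (predn 1%N _ n0).
Qed.

(** The richer Left can ruin Right at once and keep [n - b]. If Right moves first
    and takes [b], then [n - b] coins remain on the heap, of which Left can no
    longer gain all. *)
Lemma stops_apart n a b : (0 < b)%N -> (b <= a)%N -> (a + b <= n)%N ->
  right_wall (robin_hood n a b) 0 < left_wall (robin_hood n a b) 0.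
Proof.
move=> b0 le_ba le_n; have d0 : dyadic 0 := dyadic_nat 0.
have le_bn : (b <= n)%N by lia.
have := left_wall_kill d0 (lexx 0) b0 le_ba le_bn; rewrite subr0; apply: lt_le_trans.
have [ab|lt_ba] := eqVneq a b.
  apply: le_lt_trans (right_wall_kill d0 (lexx 0) _ _ _) _; [lia|lia|lia|].
  have : (b%:R < n%:R :> rat) by rewrite ltr_nat; lia.
  by rewrite ab; lra.
have := right_wall_le_option d0 (lexx 0) (mem_right_rh a b0 le_bn (leqnn b)).
rewrite addr0 => /le_lt_trans; apply.
apply: le_lt_trans (left_wall_lt_heap _ _ b0) _; first by lia.
by rewrite natrB //; lra.
Qed.

Lemma robin_hood_hot n a b : (0 < a)%N -> (0 < b)%N -> (a + b <= n)%N ->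
  hot (robin_hood n a b).
Proof.
move=> a0 b0 le_n.
have gap : right_wall (robin_hood n a b) 0 < left_wall (robin_hood n a b) 0.
  have [le_ba|lt_ab] := leqP b a; first exact: stops_apart.
  rewrite left_wall_rh right_wall_rh ltrN2; apply: stops_apart => //; lia.
have t0 := wall_gap_lt_tau gap.
by exists (tau (robin_hood n a b)) => //; exact: is_temperature_tau.
Qed.

(** * The golden ratio *)

Lemma phi_sqr (R : realType) : phi R ^+ 2 = phi R + 1.
Proof.
have := sqr_sqrtr (ler0n R 5); rewrite /phi; set s := Num.sqrt _ => s5.
have -> : (((1 + s) / 2) ^+ 2 = (1 + 2 * s + s ^+ 2) / 4) by field.
by rewrite s5; field.
Qed.

Lemma phi_gt1 (R : realType) : 1 < phi R.
Proof.
have : Num.sqrt 1 < Num.sqrt 5 :> R by rewrite ltr_sqrt ?ltr0n // ltr1n.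
rewrite sqrtr1.
by rewrite /phi; lra.
Qed.

(** The sign of [phi U_k - U_(k+1)] alternates, because this quantity is
    multiplied by [- phi^-1] at each step. *)
Lemma phi_alternates (R : realType) U k : fib_like U ->
  if odd k then phi R * (U k)%:R < (U k.+1)%:R else (U k.+1)%:R < phi R * (U k)%:R.
Proof.
move=> [Upos U10 UE]; have phi1 := phi_gt1 R; have phi2 := phi_sqr R.
have phi0 : 0 < phi R by lra.
elim: k => [|k IH] /=.
  have : (U 1)%:R <= (U 0)%:R :> R by rewrite ler_nat.
  have : 0 < (U 0)%:R :> R by rewrite ltr0n.
  by move=> u0 u1; apply: le_lt_trans u1 _; rewrite ltr_pMl.
have step : phi R * (phi R * (U k.+1)%:R - (U k.+2)%:R) = (U k.+1)%:R - phi R * (U k)%:R.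
  by rewrite UE natrD mulrBr mulrA -expr2 phi2; ring.
have signE : (0 < phi R * (U k.+1)%:R - (U k.+2)%:R) = (0 < (U k.+1)%:R - phi R * (U k)%:R).
  by rewrite -step pmulr_rgt0.
have signE' : (phi R * (U k.+1)%:R - (U k.+2)%:R < 0) = ((U k.+1)%:R - phi R * (U k)%:R < 0).
  by rewrite -step pmulr_rlt0.
case: (odd k) IH => /= lt_k; first by rewrite -subr_gt0 signE subr_gt0.
by rewrite -subr_lt0 signE' subr_lt0.
Qed.

Lemma parity_below_phi (R : realType) U q : fib_like U ->
  (phi R * (U q)%:R < (U q.+1)%:R -> odd q) /\
  ((U q.+1)%:R < phi R * (U q)%:R -> ~~ odd q).
Proof.
move=> hU; have := phi_alternates R q hU.
by case: (odd q) => lt_q; split=> // /(lt_trans lt_q); rewrite ltxx.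
Qed.

(** The two cases in which Left is the poorer player; the index of the
    starting position in the sequence is odd exactly when [b] exceeds [phi]
    times [a]. *)
Lemma poorer_left (R : realType) U a b n : fib_like U -> (0 < a)%N -> (a < b)%N ->
  (exists q, U q = a /\ U q.+1 = b) -> (4 * (a + b) <= n)%N ->
  (phi R * a%:R < b%:R ->
     freezes (robin_hood n a b) (b%:R - (U 0%N)%:R) (- (n%:R - (a%:R + b%:R) + (U 0%N)%:R))) /\
  (b%:R < phi R * a%:R ->
     freezes (robin_hood n a b) (n%:R - a%:R + ((U 0%N)%:R - b%:R) / 2) (((U 0%N)%:R - b%:R) / 2)).
Proof.
move=> hU a0 lt_ab [q [qa qb]] le_n; have [odd_q even_q] := parity_below_phi R q hU.
rewrite -qa -qb in lt_ab le_n odd_q even_q *; have [Upos U10 UE] := hU.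
rewrite addnC -UE in le_n; split=> [/odd_q odd|/even_q even].
  have [m qE] : exists m, q = m.*2.+1.
    by exists q./2; have := odd_double_half q; rewrite odd add1n.
  rewrite -/(pingala_pos U n q) (_ : - (n%:R - _ + _) = - (n%:R - pingala_gap U q.+2)).
    by rewrite qE in le_n *; exact: freezes_odd.
  by rewrite /pingala_gap UE natrD; ring.
have [m qE] : exists m, q = m.*2.
  by exists q./2; have := odd_double_half q; rewrite (negbTE even) add0n.
case: m qE => [q0|m qE]; first by move: lt_ab; rewrite q0 ltnNge U10.
by rewrite -/(pingala_pos U n q) qE doubleS in le_n *; exact: freezes_even.
Qed.

Theorem theorem1p1 (R : realType) (a b : nat) (U : nat -> nat)
    (ha : (0 < a)%N) (hb : (0 < b)%N) (hU : pingala a b U) :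
  (forall n : nat, (0 < n)%N -> (a + b <= n)%N -> hot (robin_hood n a b)) /\
  (exists n0 : nat, forall n : nat, (0 < n)%N -> (n0 <= n)%N ->
    let G := robin_hood n a b in
    let r : R := a%:R / b%:R in
    [/\ r < (phi R)^-1 ->
          is_temperature G (b%:R - (U 0%N)%:R) /\
          is_mean_value G (- (n%:R - (a%:R + b%:R) + (U 0%N)%:R)),
        (phi R)^-1 < r /\ r < 1 ->
          is_temperature G (n%:R - a%:R + ((U 0%N)%:R - b%:R) / 2) /\
          is_mean_value G (((U 0%N)%:R - b%:R) / 2),
        r = 1 ->
          is_temperature G (n%:R - a%:R) /\
          is_mean_value G 0,
        1 < r /\ r < phi R ->
          is_temperature G (n%:R - b%:R + ((U 0%N)%:R - a%:R) / 2) /\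
          is_mean_value G ((a%:R - (U 0%N)%:R) / 2)
      & phi R < r ->
          is_temperature G (a%:R - (U 0%N)%:R) /\
          is_mean_value G (n%:R - (a%:R + b%:R) + (U 0%N)%:R)]).
Proof.
have [Upos U10 UE [q [qmin qmax]]] := hU.
have fU : fib_like U by [].
split=> [n _ le_n|]; first exact: robin_hood_hot.
exists (4 * (a + b))%N => n _ le_n G r.
have le_n' : (4 * (b + a) <= n)%N by rewrite addnC.
have phi1 := phi_gt1 R; have phi0 : 0 < phi R by exact: lt_trans phi1.
have a0 : 0 < a%:R :> R by rewrite ltr0n.
have b0 : 0 < b%:R :> R by rewrite ltr0n.
have r_lt1 : (r < 1) = (a < b)%N by rewrite ltr_pdivrMr // mul1r ltr_nat.
have r_gt1 : (1 < r) = (b < a)%N by rewrite ltr_pdivlMr // mul1r ltr_nat.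
have poor_left : (a < b)%N -> exists q, U q = a /\ U q.+1 = b.
  by move=> lt_ab; exists q; rewrite qmin qmax (minn_idPl (ltnW lt_ab)) (maxn_idPr (ltnW lt_ab)).
have poor_right : (b < a)%N -> exists q, U q = b /\ U q.+1 = a.
  by move=> lt_ba; exists q; rewrite qmin qmax (minn_idPr (ltnW lt_ba)) (maxn_idPl (ltnW lt_ba)).
have r_lt_inv : (r < (phi R)^-1) = (phi R * a%:R < b%:R).
  by rewrite ltr_pdivrMr // mulrC ltr_pdivlMr // mulrC.
have r_gt_inv : ((phi R)^-1 < r) = (b%:R < phi R * a%:R).
  by rewrite ltr_pdivlMr // mulrC ltr_pdivrMr // mulrC.
split.
- rewrite r_lt_inv => lt_r; have lt_ab : (a < b)%N.
    by rewrite -(ltr_nat R); apply: lt_trans lt_r; rewrite ltr_pMl.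
  apply: freezes_temperature_mean.
  exact: (poorer_left R fU ha lt_ab (poor_left lt_ab) le_n).1 lt_r.
- rewrite r_gt_inv r_lt1 => -[lt_r lt_ab]; apply: freezes_temperature_mean.
  exact: (poorer_left R fU ha lt_ab (poor_left lt_ab) le_n).2 lt_r.
- move=> r1; have ab : a = b.
    have : ~~ (a < b)%N by rewrite -r_lt1 r1 ltxx.
    have : ~~ (b < a)%N by rewrite -r_gt1 r1 ltxx.
    by case: ltngtP.
  have le_a : (4 * a <= n)%N.
    by apply: leq_trans le_n; rewrite leq_mul2l leq_addr.
  by apply: freezes_temperature_mean; rewrite /G -ab; exact: freezes_equal.
- rewrite r_gt1 ltr_pdivrMr // => -[lt_ba lt_r]; apply: freezes_temperature_mean.
  have := (poorer_left R fU hb lt_ba (poor_right lt_ba) le_n').2 lt_r.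
  by move=> /freezes_opp; rewrite robin_hood_opp -mulNr opprB.
rewrite ltr_pdivlMr // => lt_r; have lt_ba : (b < a)%N.
  by rewrite -(ltr_nat R); apply: lt_trans lt_r; rewrite ltr_pMl.
apply: freezes_temperature_mean.
have := (poorer_left R fU hb lt_ba (poor_right lt_ba) le_n').1 lt_r.
by move=> /freezes_opp; rewrite robin_hood_opp opprK [b%:R + _]addrC.
Qed.
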